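(* Fix an integer $\Lambda\ge2$ and let $G=(V,E)$ be a loopless series-parallel graph of maxmaxflow at most $\Lambda$. Let $\rho^\star_\Lambda$ be the unique solution in $(0,1)$ of $(1+\rho)^\Lambda=2(1+\rho^2)^{\Lambda-1}$ when $\Lambda\ge3$, and $\rho^\star_2=1$. Let $q\in\mathbb C$ satisfy $|q-1|\ge1/\rho^\star_\Lambda$ (strict inequality $>$ when $\Lambda=2$), put $\rho=1/|q-1|$ and $X=\big(2/(1+\rho)\big)^{1/(\Lambda-1)}$, and let edge weights $\mathbf v=(v_e)_{e\in E}$ satisfy, for each $e$, either $v_e=-1$ or $q+v_e\neq0$ and $\left|\dfrac{v_e}{q+v_e}\right|\le\rho\,\dfrac{X-1}{1-\rho X}$ (with strict inequality when $\Lambda=2$). Then $Z_G(q,\mathbf v)\neq0$. Furthermore $\rho^\star_\Lambda>(\log2)/(\Lambda-\tfrac32\log2)$ for every integer $\Lambda\ge2$; in particular all roots of the chromatic polynomial $P_G(q)$ lie in the disc $|q-1|<(\Lambda-\tfrac32\log2)/\log2$.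
   Context: Multivariate Tutte polynomial of $G=(V,E)$: $Z_G(q,\mathbf v)=\sum_{A\subseteq E}q^{k(A)}\prod_{e\in A}v_e$, $k(A)$ = number of connected components of $(V,A)$; chromatic polynomial $P_G(q)=Z_G(q,\mathbf v)$ with all $v_e=-1$. $\lambda_G(x,y)$ = maximum number of pairwise edge-disjoint $x$–$y$ paths; maxmaxflow $\Lambda(G)=\max_{x\ne y}\lambda_G(x,y)$ (0 if fewer than two vertices). A loopless graph is series-parallel if it can be obtained from a forest by a finite (possibly empty) sequence of operations, each replacing an edge by two edges in series (subdivision) or by two parallel edges. *)

(* Defs.v *)
From Stdlib Require Import Reals.
From HB Require Import structures.
From mathcomp Require Import all_boot.

Set Implicit Arguments.
Unset Strict Implicit.
Unset Printing Implicit Defensive.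

Local Open Scope R_scope.

Record cplx := Cx { re : R; im : R }.

Definition Czero : cplx := Cx 0 0.
Definition Cone : cplx := Cx 1 0.
Definition Cadd (a b : cplx) : cplx := Cx (re a + re b) (im a + im b).
Definition Copp (a : cplx) : cplx := Cx (- re a) (- im a).
Definition Csub (a b : cplx) : cplx := Cadd a (Copp b).
Definition Cmul (a b : cplx) : cplx :=
  Cx (re a * re b - im a * im b) (re a * im b + im a * re b).
Definition Cnorm (a : cplx) : R := sqrt (re a * re a + im a * im a).
Definition Cinv (a : cplx) : cplx :=
  let d := (re a * re a + im a * im a) in Cx (re a / d) (- im a / d).
Definition Cdiv (a b : cplx) : cplx := Cmul a (Cinv b).
Fixpoint Cpow (a : cplx) (n : nat) : cplx :=
  match n with O => Cone | S k => Cmul a (Cpow a k) end.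

(* Finite multigraphs: vertices 0..nv-1, edges = list of endpoint pairs *)
(* (parallel edges allowed); edge i is the i-th entry of [edges].      *)

Local Close Scope R_scope.

Record mgraph := MGraph { nv : nat; edges : seq (nat * nat) }.

Definition ne (G : mgraph) : nat := size (edges G).
Definition endp (G : mgraph) (i : nat) : nat * nat := nth (0, 0) (edges G) i.

Definition wf_graph (G : mgraph) : bool :=
  all (fun p => (p.1 < nv G) && (p.2 < nv G)) (edges G).
Definition loopless (G : mgraph) : bool := all (fun p => p.1 != p.2) (edges G).

Definition incident (G : mgraph) (i x : nat) : bool :=
  ((endp G i).1 == x) || ((endp G i).2 == x).
Definition other (G : mgraph) (i x : nat) : nat :=
  if (endp G i).1 == x then (endp G i).2 else (endp G i).1.

Fixpoint walk (G : mgraph) (x y : nat) (s : seq nat) : bool :=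
  match s with
  | [::] => x == y
  | i :: s' => [&& i < ne G, incident G i x & walk G (other G i x) y s']
  end.

Fixpoint trail (G : mgraph) (x : nat) (s : seq nat) : seq nat :=
  match s with
  | [::] => [:: x]
  | i :: s' => x :: trail G (other G i x) s'
  end.

Definition is_path (G : mgraph) (x y : nat) (s : seq nat) : bool :=
  walk G x y s && uniq (trail G x s).

Definition edge_disjoint_paths (G : mgraph) (x y : nat) (P : seq (seq nat)) : bool :=
  all (is_path G x y) P && uniq (flatten P).

Definition maxmaxflow_le (G : mgraph) (L : nat) : Prop :=
  forall x y, x < nv G -> y < nv G -> x != y ->
  forall P, edge_disjoint_paths G x y P -> size P <= L.

Definition is_cycle (G : mgraph) (x : nat) (s : seq nat) : bool :=
  [&& 0 < size s, uniq s, walk G x x s & uniq (behead (trail G x s))].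

Definition forest (G : mgraph) : Prop :=
  [/\ wf_graph G, loopless G & ~ (exists x s, x < nv G /\ is_cycle G x s)].

Definition subdivide (G : mgraph) (i : nat) : mgraph :=
  MGraph (nv G).+1
    (set_nth (0, 0) (edges G) i ((endp G i).1, nv G) ++ [:: (nv G, (endp G i).2)]).

Definition parallel (G : mgraph) (i : nat) : mgraph :=
  MGraph (nv G) (edges G ++ [:: endp G i]).

Definition iso (G H : mgraph) : Prop :=
  nv G = nv H /\ ne G = ne H /\
  exists (f g : nat -> nat),
    [/\ forall x, x < nv G -> f x < nv H,
        {in [pred x | x < nv G] &, injective f},
        forall i, i < ne G -> g i < ne H,
        {in [pred i | i < ne G] &, injective g} &
        forall i, i < ne G ->
          endp H (g i) = (f (endp G i).1, f (endp G i).2) \/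
          endp H (g i) = (f (endp G i).2, f (endp G i).1)].

Inductive series_parallel : mgraph -> Prop :=
| sp_forest G : forest G -> series_parallel G
| sp_series G i : series_parallel G -> i < ne G -> series_parallel (subdivide G i)
| sp_parallel G i : series_parallel G -> i < ne G -> series_parallel (parallel G i)
| sp_iso G H : series_parallel G -> iso G H -> series_parallel H.

Definition adjA (G : mgraph) (A : {set 'I_(ne G)}) : rel 'I_(nv G) :=
  fun x y => [exists e in A,
     (((endp G e).1 == x) && ((endp G e).2 == y)) ||
     (((endp G e).1 == y) && ((endp G e).2 == x))].

Definition ncomp (G : mgraph) (A : {set 'I_(ne G)}) : nat :=
  n_comp (adjA A) predT.

Definition ZG (G : mgraph) (q : cplx) (v : 'I_(ne G) -> cplx) : cplx :=
  foldr Cadd Czero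
    [seq Cmul (Cpow q (ncomp A)) (foldr Cmul Cone [seq v e | e <- enum A])
    | A <- enum [set: {set 'I_(ne G)}]].

Arguments ZG : clear implicits.

Definition chromP (G : mgraph) (q : cplx) : cplx := ZG G q (fun _ => Copp Cone).

Local Open Scope R_scope.

Definition is_rho_star (L : nat) (r : R) : Prop :=
  (L = 2%N /\ r = 1) \/
  ((3 <= L)%N /\ (0 < r < 1) /\ ((1 + r) ^ L = 2 * (1 + r ^ 2) ^ (L - 1)%N)).

Definition le_or_lt_R (strict : bool) (a b : R) : Prop :=
  if strict then (a < b) else (a <= b).

(* Main.v *)
From Coquelicot Require Import Coquelicot.
Require Import Defs.
From Stdlib Require Import Reals Lra Psatz Ring Permutation.
From HB Require Import structures.
From mathcomp Require Import all_boot zify.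

(** Let every edge carry a pair of weights [(a, b)], [a] for its absence and [b] for its
    presence, and a capacity.  Two edges in series or in parallel can then be replaced by
    a single one without changing [Z] at all.  In terms of the transmissivity
    [t = b / (q a + b) = v / (q + v)], series connection multiplies the [t]'s, and by the
    triangle inequality parallel connection is worst at [q - 1 = - 1 / rho] and [t < 0],
    where it becomes multiplicative in [Y] under [|t| = rho (Y - 1) / (1 - rho Y)].  Hence an
    edge of capacity [c < Lambda] that is not a bridge keeps [v = -1] or
    [|t| <= rho (X^c - 1) / (1 - rho X^c) <= rho]: a parallel connection adds the capacities,
    while a series connection gives [|t| <= rho^2], which is allowed for capacity [1] exactly
    when [(1 + rho)^Lambda <= 2 (1 + rho^2)^(Lambda - 1)].  The maxmaxflow bound forces
    [c < Lambda] for every edge that is not a bridge, and survives the reductions; a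
    forest has only bridges, for which [q a + b <> 0] suffices. *)

Set Implicit Arguments.
Unset Strict Implicit.
Unset Printing Implicit Defensive.

(** * Complex numbers and the bound on rho *)

Local Open Scope R_scope.

Lemma cplx_eq (a b : cplx) : re a = re b -> im a = im b -> a = b.
Proof. by case: a b => [x y] [x' y'] /= -> ->. Qed.

Lemma cplx_ring :
  ring_theory Czero Cone Cadd Cmul Csub Copp (@eq cplx).
Proof.
split; intros; rewrite /Csub /Cadd /Cmul /Copp /Cone /Czero;
  apply: cplx_eq => /=; ring.
Qed.
Add Ring cplx_ring : cplx_ring.

Lemma Cnorm_ge0 a : 0 <= Cnorm a.
Proof. exact: sqrt_pos. Qed.

Lemma CnormM a b : Cnorm (Cmul a b) = Cnorm a * Cnorm b.
Proof.
rewrite /Cnorm -sqrt_mult_alt /=; last nra.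
congr sqrt; ring.
Qed.

Lemma CnormN a : Cnorm (Copp a) = Cnorm a.
Proof. rewrite /Cnorm /=; congr sqrt; ring. Qed.

Lemma CnormD a b : Cnorm (Cadd a b) <= Cnorm a + Cnorm b.
Proof.
case: a b => [x y] [x' y']; rewrite /Cnorm /=.
have := sqrt_cauchy x y x' y'.
rewrite /Rsqr => cauchy.
have h1 := sqrt_pos (x * x + y * y); have h2 := sqrt_pos (x' * x' + y' * y').
apply: Rsqr_incr_0_var; last lra.
rewrite Rsqr_plus !Rsqr_sqrt; first (by lra);
  by apply: Rplus_le_le_0_compat; apply: Rle_0_sqr.
Qed.

Lemma Cnorm_eq0 a : Cnorm a = 0 -> a = Czero.
Proof.
case: a => x y; rewrite /Cnorm /= => h.
have {}h : x * x + y * y = 0 by apply: sqrt_eq_0 => //; nra.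
by apply: cplx_eq => /=; nra.
Qed.

Lemma Cnorm0 : Cnorm Czero = 0.
Proof. by rewrite /Cnorm /= Rmult_0_r Rplus_0_r sqrt_0. Qed.

Lemma Cnorm1 : Cnorm Cone = 1.
Proof. by rewrite /Cnorm /= !Rmult_0_r Rplus_0_r Rmult_1_r sqrt_1. Qed.

Lemma Cnorm_gt0 a : a <> Czero -> 0 < Cnorm a.
Proof.
move=> a0; case: (Cnorm_ge0 a) => // /esym /Cnorm_eq0; by [].
Qed.

Lemma Cmul_neq0 a b : a <> Czero -> b <> Czero -> Cmul a b <> Czero.
Proof.
move=> /Cnorm_gt0 ha /Cnorm_gt0 hb h.
have := CnormM a b; rewrite h Cnorm0; nra.
Qed.

Lemma Cdiv_mulK a b : b <> Czero -> Cmul (Cdiv a b) b = a.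
Proof.
move=> b0.
have d0 : re b * re b + im b * im b <> 0.
  move=> d; apply: b0; apply: Cnorm_eq0; by rewrite /Cnorm d sqrt_0.
by apply: cplx_eq => /=; field.
Qed.

(** * Logarithm estimates and the lower bound on the critical radius *)

Lemma derive_ge0_le (h dh : R -> R) x : 0 < x ->
  (forall t, 0 <= t <= x -> is_derive h t (dh t)) ->
  (forall t, 0 < t < x -> 0 <= dh t) -> h 0 <= h x.
Proof.
move=> x0 hd dpos.
have [|c [hc e]] := MVT_cor2 h dh 0 x x0.
  by move=> c hc; apply/is_derive_Reals; exact: hd.
have := dpos c e; nra.
Qed.

Lemma ln1p_upper x : 0 < x -> ln (1 + x) <= x - x ^ 2 / 2 + x ^ 3 / 3.
Proof.
move=> x0.
have := @derive_ge0_le (fun t => t - t ^ 2 / 2 + t ^ 3 / 3 - ln (1 + t))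
  (fun t => t ^ 3 / (1 + t)) x x0.
rewrite Rplus_0_r ln_1 => h; suff : 0 - 0 ^ 2 / 2 + 0 ^ 3 / 3 - 0 <=
  x - x ^ 2 / 2 + x ^ 3 / 3 - ln (1 + x) by lra.
apply: h => t ht; first by auto_derive; [lra | field; lra].
apply: Rmult_le_pos; first by apply: pow_le; lra.
by apply: Rlt_le; apply: Rinv_0_lt_compat; lra.
Qed.

Lemma ln1p_lower x : 0 < x -> x - x ^ 2 / 2 <= ln (1 + x).
Proof.
move=> x0.
have := @derive_ge0_le (fun t => ln (1 + t) - (t - t ^ 2 / 2))
  (fun t => t ^ 2 / (1 + t)) x x0.
rewrite Rplus_0_r ln_1 => h; suff : 0 - (0 - 0 ^ 2 / 2) <=
  ln (1 + x) - (x - x ^ 2 / 2) by lra.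
apply: h => t ht; first by auto_derive; [lra | field; lra].
apply: Rmult_le_pos; first by apply: pow_le; lra.
by apply: Rlt_le; apply: Rinv_0_lt_compat; lra.
Qed.

(* [ln 2 = ln ((1 + 1/3) / (1 - 1/3))] *)
Lemma ln2_bounds : 0.691 < ln 2 < 0.6945.
Proof.
have e2 : ln 2 = ln (1 + 1 / 3) - ln (1 - 1 / 3).
  have -> : 2 = (1 + 1 / 3) * / (1 - 1 / 3) by field.
  rewrite ln_mult ?ln_Rinv; try lra. 
pose g t := ln (1 + t) - ln (1 - t).
have dg t : 0 <= t <= 1 / 3 -> is_derive g t (2 / (1 - t ^ 2)).
  move=> ht; rewrite /g; auto_derive; first lra. field; nra.
have hmvt (h dh : R -> R) : (forall t, 0 <= t <= 1 / 3 -> is_derive h t (dh t)) ->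
   h 0 = 0 -> (forall t, 0 < t < 1 / 3 -> 0 <= dh t) -> 0 <= h (1 / 3).
  by move=> hd h0 dpos; have := @derive_ge0_le h dh (1 / 3) ltac:(lra) hd dpos; rewrite h0.
have lo : 0 <= g (1 / 3) - (2 * (1 / 3) + 2 / 3 * (1 / 3) ^ 3).
  apply: (hmvt (fun t => g t - (2 * t + 2 / 3 * t ^ 3)) (fun t => 2 / (1 - t ^ 2) - (2 + 2 * t ^ 2))).
  - move=> t ht; apply: is_derive_minus; first exact: dg.
    auto_derive => //; field.
  - by rewrite /g Rplus_0_r Rminus_0_r; ring.
  move=> t ht.
  have -> : 2 / (1 - t ^ 2) - (2 + 2 * t ^ 2) = 2 * t ^ 4 / (1 - t ^ 2) by field; nra.
  apply: Rmult_le_pos; first by have := pow_le t 4 ltac:(lra); lra.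
  apply: Rlt_le; apply: Rinv_0_lt_compat; nra.
(* The Taylor coefficient [2/3] is raised to [3/4]: the derivative of the difference is then a
   positive multiple of [t^2 * (1 - 9 * t^2)], nonnegative exactly up to [t = 1/3]. *)
have up : 0 <= (2 * (1 / 3) + 3 / 4 * (1 / 3) ^ 3) - g (1 / 3).
  apply: (hmvt (fun t => (2 * t + 3 / 4 * t ^ 3) - g t) (fun t => (2 + 9 / 4 * t ^ 2) - 2 / (1 - t ^ 2))).
  - move=> t ht; apply: is_derive_minus; last exact: dg.
    auto_derive => //; field.
  - by rewrite /g Rplus_0_r Rminus_0_r; ring.
  move=> t ht.
  have -> : 2 + 9 / 4 * t ^ 2 - 2 / (1 - t ^ 2) = t ^ 2 * (1 - 9 * t ^ 2) / 4 / (1 - t ^ 2)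
    by field; nra.
  apply: Rmult_le_pos.
    have : 0 <= t ^ 2 by nra. have : 0 <= 1 - 9 * t ^ 2 by nra. nra.
  apply: Rlt_le; apply: Rinv_0_lt_compat; nra.
rewrite /g -e2 in lo up; lra.
Qed.

(** The defining equation of the critical radius turned into an inequality. For [L = 2] it reads
    [0 <= (1 - rho)^2] and always holds, so [rho < 1] is carried separately. *)
Definition admissible (L : nat) (rho : R) : Prop :=
  (1 + rho) ^ L <= 2 * (1 + rho ^ 2) ^ (L - 1).

Lemma INR_ge n m : (n <= m)%N -> INR n <= INR m.
Proof. by move=> /leP /le_INR. Qed.

(** After taking logarithms, [L * (A - B) + B < ln 2] is wanted, with [A = ln (1 + rho)] and
    [B = ln (1 + rho^2)]. The hypothesis gives [L * rho <= ln 2 * (1 + 3/2 * rho)], while [A - B] is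
    at most [rho - 3/2 * rho^2 + ...]. The constant [3/2] makes the first-order terms of the product
    cancel, and the second-order gain exceeds [B <= rho^2]. *)
Lemma disc_admissible_lt (L : nat) (rho : R) : (2 <= L)%N -> 0 < rho ->
  rho <= ln 2 / (INR L - 3 / 2 * ln 2) ->
  rho < 1 /\ (1 + rho) ^ L < 2 * (1 + rho ^ 2) ^ (L - 1).
Proof.
move=> hL r0 hr; have [l1 l2] := ln2_bounds.
have hL2 := INR_ge hL; rewrite /= in hL2.
have d0 : 0 < INR L - 3 / 2 * ln 2 by lra.
have hr' : rho * (INR L - 3 / 2 * ln 2) <= ln 2.
  apply: (Rmult_le_reg_r (/ (INR L - 3 / 2 * ln 2))); first exact: Rinv_0_lt_compat.
  by rewrite Rmult_assoc Rinv_r ?Rmult_1_r //; lra.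
have r1 : rho < 1 by nra.
split=> //.
case: (ltnP 2 L) => [L3|L2]; last first.
  have -> : L = 2%N by apply/eqP; rewrite eqn_leq L2 hL.
  rewrite /=; nra.
have hL3 := INR_ge L3; rewrite /= in hL3.
(* The bound for [L = 3]; it is what brings the second-order coefficient [q1] below above [1]. *)
have r35 : rho < 0.355 by nra.
have lnpos : 0 < 2 * (1 + rho ^ 2) ^ (L - 1).
  apply: Rmult_lt_0_compat; first lra. apply: pow_lt; nra.
apply: ln_lt_inv => //; first by apply: pow_lt; lra.
have r2pos : 0 < 1 + rho ^ 2 by nra.
rewrite ln_mult; [|lra|exact: pow_lt].
rewrite !ln_pow //; last lra.
rewrite minus_INR; last by apply/leP; exact: leq_trans hL.
rewrite [INR 1]/=.
have u1 := ln1p_upper r0.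
have rr : 0 < rho ^ 2 by nra.
have u2 := ln1p_lower rr.
have u3 : ln (1 + rho ^ 2) <= rho ^ 2.
  have := exp_ineq1_le (rho ^ 2) => h.
  rewrite -[X in _ <= X]ln_exp; apply: ln_le; lra.
set A := ln (1 + rho) in u1 *; set B := ln (1 + rho ^ 2) in u2 u3 *.
pose D := rho - 3 / 2 * rho ^ 2 + rho ^ 3 / 3 + rho ^ 4 / 2.
have hD : A - B <= D by rewrite /D; nra.
have D0 : 0 < D.
  rewrite /D. have : 0 < rho * (1 - 3 / 2 * rho) by nra.
  have := pow_lt rho 3 r0; have := pow_lt rho 4 r0; nra.
have step : rho * (INR L * (A - B)) <= ln 2 * (1 + 3 / 2 * rho) * D.
  apply: Rle_trans (_ : rho * INR L * D <= _).
    by rewrite -Rmult_assoc; apply: Rmult_le_compat_l => //; apply: Rmult_le_pos; lra.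
  by apply: Rmult_le_compat_r; nra.
have eD : ln 2 * (1 + 3 / 2 * rho) * D =
   rho * (ln 2 - ln 2 * (23 / 12 - rho - 3 / 4 * rho ^ 2) * rho ^ 2) by rewrite /D; field.
have q1 : 1.0001 < ln 2 * (23 / 12 - rho - 3 / 4 * rho ^ 2) by nra.
rewrite eD in step.
have {}step : INR L * (A - B) <= ln 2 - ln 2 * (23 / 12 - rho - 3 / 4 * rho ^ 2) * rho ^ 2.
  exact: Rmult_le_reg_l step.
nra.
Qed.

(** Otherwise [disc_admissible_lt] at [rho = rs] makes the defining equation of [rs] a strict
    inequality or, for [L = 2], gives [1 < 1]. *)
Lemma rho_star_gt (L : nat) (rs : R) : (2 <= L)%N -> is_rho_star L rs ->
  ln 2 / (INR L - 3 / 2 * ln 2) < rs.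
Proof.
move=> hL hs; apply: Rnot_le_lt => hle.
have rs0 : 0 < rs by case: hs => [[_ ->]|[_ [h _]]]; lra.
have [h1 h2] := disc_admissible_lt hL rs0 hle.
by case: hs => [[_ e]|[_ [_ e]]]; lra.
Qed.

(* Up to a positive factor, the derivative of
   [L ln (1 + x) - (L - 1) ln (1 + x^2)] is [L - 2 (L - 1) x - (L - 2) x^2],
   which is decreasing, and the function takes the same value [ln 2] at [rs] and at [1]. *)
Lemma admissible_below (L : nat) (rs rho : R) : (3 <= L)%N -> 0 < rs < 1 ->
  (1 + rs) ^ L = 2 * (1 + rs ^ 2) ^ (L - 1) -> 0 < rho <= rs -> admissible L rho.
Proof.
move=> hL hrs ers hrho.
have hL3 := INR_ge hL; rewrite /= in hL3.
pose f x := INR L * ln (1 + x) - (INR L - 1) * ln (1 + x ^ 2).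
pose g x := (INR L - 2 * (INR L - 1) * x - (INR L - 2) * x ^ 2).
pose f' x := g x / ((1 + x) * (1 + x ^ 2)).
have fL x : 0 < x -> f x = ln ((1 + x) ^ L) - ln ((1 + x ^ 2) ^ (L - 1)).
  move=> x0; rewrite !ln_pow; try nra.
  by rewrite minus_INR //; apply/leP; exact: leq_trans hL.
have df x : 0 < x -> derivable_pt_lim f x (f' x).
  move=> x0; apply/is_derive_Reals; rewrite /f /f' /g; auto_derive; first by split; nra.
  field; nra.
have pp x : 0 < x -> 0 < (1 + x ^ 2) ^ (L - 1) by move=> x0; apply: pow_lt; nra.
have frs : f rs = ln 2.
  rewrite fL; last lra. rewrite ers ln_mult; try lra; by apply: pp; lra.
have f1 : f 1 = ln 2.
  rewrite /f; have -> : 1 + 1 ^ 2 = 1 + 1 by ring. have -> : 1 + 1 = 2 by ring. ring.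
rewrite /admissible; apply: Rnot_lt_le => hbad.
have flt : ln 2 < f rho.
  rewrite fL; last lra.
  have := ln_increasing _ _ (Rmult_lt_0_compat 2 _ ltac:(lra) (pp rho ltac:(lra))) hbad.
  rewrite ln_mult; [lra | lra | apply: pp; lra].
have rlt : rho < rs.
  by case: (Rle_lt_or_eq_dec rho rs ltac:(lra)) => // e; move: flt; rewrite e frs; lra.
have [|c [hc e]] := MVT_cor2 f f' rho rs rlt.
  by move=> c hc; apply: df; lra.
have [|c2 [hc2 e2]] := MVT_cor2 f f' rs 1 ltac:(lra).
  by move=> c2 hc2; apply: df; lra.
have fc : f' c < 0 by rewrite frs in hc; nra.
have fc2 : f' c2 = 0 by rewrite frs f1 in hc2; nra.
have sg x : 0 < x -> g x = f' x * ((1 + x) * (1 + x ^ 2)).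
  by move=> x0; rewrite /f'; field; nra.
have gc : g c < 0.
  rewrite sg; last lra. have : 0 < (1 + c) * (1 + c ^ 2) by nra. nra.
have gc2 : g c2 = 0 by rewrite sg; [rewrite fc2; ring | lra].
(* The product is [g c - g c2], while [c < rs < c2], [g c < 0] and [g c2 = 0]. *)
have : 0 < (c2 - c) * (2 * (INR L - 1) + (INR L - 2) * (c + c2)).
  apply: Rmult_lt_0_compat; first lra.
  have : 0 <= (INR L - 2) * (c + c2) by apply: Rmult_le_pos; lra.
  lra.
rewrite /g in gc gc2; lra.
Qed.

(** * Connectivity and numbers of components *)

Local Open Scope nat_scope.

Definition joins (e : nat * nat) (u v : nat) : bool := (e == (u, v)) || (e == (v, u)).
(** Connectivity is read off a list of endpoint pairs on all of [nat], so that making an edge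
    present is a mere cons and the vertex count can change freely. *)
Definition adj (S : seq (nat * nat)) : rel nat := fun u v => has (fun e => joins e u v) S.
Definition conn (S : seq (nat * nat)) (x y : nat) : Prop :=
  exists2 p, path (adj S) x p & last x p = y.
Definition ends_below (n : nat) (S : seq (nat * nat)) : bool :=
  all (fun e => (e.1 < n) && (e.2 < n)) S.

Lemma joinsC e u v : joins e u v = joins e v u.
Proof. exact: orbC. Qed.

Lemma joinsE x y u v : joins (x, y) u v = joins (u, v) x y.
Proof. by rewrite /joins !xpair_eqE; lia. Qed.

Lemma joins_swap x y u v : joins (y, x) u v = joins (x, y) u v.
Proof. by rewrite joinsE joinsC -joinsE. Qed.

Lemma joins_id x y : joins (x, y) x y.
Proof. by rewrite /joins eqxx. Qed.

Lemma joinsP e u v : reflect ((e.1 = u /\ e.2 = v) \/ (e.1 = v /\ e.2 = u)) (joins e u v).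
Proof.
case: e => x y; rewrite /joins !xpair_eqE /=.
apply: (iffP orP) => [[] /andP [/eqP -> /eqP ->]|[[-> ->]|[-> ->]]]; rewrite ?eqxx; auto.
Qed.

Lemma adjC S u v : adj S u v = adj S v u.
Proof. by apply: eq_has => e; exact: joinsC. Qed.

Lemma adj_below n S u v : ends_below n S -> adj S u v -> (u < n) && (v < n).
Proof.
move=> /allP bS /hasP [e /bS /andP [h1 h2] /joinsP]; case=> [[<- <-]|[<- <-]]; by rewrite h1 h2.
Qed.

Lemma adj_perm S S' : Permutation S S' -> adj S =2 adj S'.
Proof.
move=> pS u v; rewrite /adj; elim: pS => //= [e s s' _ -> //|e e' s|s1 s2 s3 _ -> _ -> //].
by rewrite orbCA.
Qed.

Lemma conn_refl S x : conn S x x.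
Proof. by exists [::]. Qed.

Lemma conn_trans S y x z : conn S x y -> conn S y z -> conn S x z.
Proof.
move=> [p pp lp] [s ps ls]; exists (p ++ s); first by rewrite cat_path pp lp ps.
by rewrite last_cat lp.
Qed.

Lemma conn_adj S x y : adj S x y -> conn S x y.
Proof. by move=> h; exists [:: y] => //=; rewrite h. Qed.

(** With [f = id] this compares two edge lists; with [f] moving the last vertex onto a neighbour it
    carries connectivity through a contraction. *)
Lemma conn_lift (f : nat -> nat) S S' x y :
  (forall u v, adj S u v -> conn S' (f u) (f v)) -> conn S x y -> conn S' (f x) (f y).
Proof.
move=> h [p]; elim: p x => [|z p IH] x /=; first by move=> _ ->; exact: conn_refl.
by case/andP=> /h xz pz lz; apply: conn_trans xz _; exact: IH.
Qed.

Lemma conn_sub S S' x y : (forall u v, adj S u v -> adj S' u v) -> conn S x y -> conn S' x y.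
Proof. by move=> h; apply: (@conn_lift id) => u v /h /conn_adj. Qed.

Lemma conn_cons e S x y : conn S x y -> conn (e :: S) x y.
Proof. by apply: conn_sub => u v /= ->; rewrite orbT. Qed.

Lemma conn_perm S S' x y : Permutation S S' -> conn S x y -> conn S' x y.
Proof. by move=> /adj_perm h; apply: conn_sub => u v; rewrite h. Qed.

Lemma conn_sym S x y : conn S x y -> conn S y x.
Proof.
move=> [p]; elim: p x => [|z p IH] x /=; first by move=> _ ->; exact: conn_refl.
case/andP=> xz pz lz; apply: conn_trans (IH _ pz lz) _.
by apply: conn_adj; rewrite adjC.
Qed.

Lemma conn_eq (T : Type) (r : nat -> T) S x y :
  (forall u v, adj S u v -> r u = r v) -> conn S x y -> r x = r y.
Proof.
move=> h [p]; elim: p x => [|z p IH] x /=; first by move=> _ ->.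
by case/andP=> /h -> pz lz; exact: IH.
Qed.

Definition merge (r : nat -> nat) (x y z : nat) : nat := if r z == r x then r y else r z.
(** Computable class labels in the manner of union-find, one merge per edge; components are then
    counted as distinct labels. *)
Definition label (S : seq (nat * nat)) : nat -> nat :=
  foldr (fun e r => merge r e.1 e.2) id S.

Lemma labelP S x y : conn S x y <-> label S x = label S y.
Proof.
elim: S x y => [|[x y] S IH] u v /=.
  by split=> [|<-]; [exact: conn_eq | exact: conn_refl].
set r := label S in IH *; split.
  apply: conn_eq => {u v} u v /orP [/joinsP|h].
    by case=> [[<- <-]|[<- <-]]; rewrite /merge !eqxx /=; case: ifP.
  by rewrite /merge; have -> : r u = r v by apply/IH; exact: conn_adj.
have xy : conn ((x, y) :: S) x y by apply: conn_adj; rewrite /= joins_id.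
rewrite /merge; case: ifP => [/eqP ux|_]; case: ifP => [/eqP vx|_].
- by move=> _; apply: conn_cons; apply/IH; rewrite ux.
- move=> yv; apply: conn_trans (_ : conn _ x _); first by apply: conn_cons; apply/IH.
  by apply: conn_trans xy _; apply: conn_cons; apply/IH.
- move=> uy; apply: conn_trans (_ : conn _ y _); first by apply: conn_cons; apply/IH.
  by apply: conn_trans (conn_sym xy) _; apply: conn_cons; apply/IH.
by move=> uv; apply: conn_cons; apply/IH.
Qed.

Definition ncard (T : eqType) (n : nat) (r : nat -> T) : nat :=
  size (undup [seq r x | x <- iota 0 n]).
Definition comps (n : nat) (S : seq (nat * nat)) : nat := ncard n (label S).

Lemma ncardS (T : eqType) n (r : nat -> T) :
  ncard n.+1 r = (r n \notin [seq r x | x <- iota 0 n]) + ncard n r.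
Proof.
rewrite /ncard -addn1 iotaD map_cat /= add0n cats1.
rewrite (perm_size (perm_undup (_ : _ =i r n :: [seq r x | x <- iota 0 n]))) /=.
  by case: ifP.
by move=> z; rewrite mem_rcons.
Qed.

Lemma ncard_eq (T T' : eqType) n (r : nat -> T) (r' : nat -> T') :
  (forall x y, x < n -> y < n -> (r x = r y <-> r' x = r' y)) -> ncard n r = ncard n r'.
Proof.
elim: n => [//|n IH] h; rewrite !ncardS IH; last first.
  by move=> x y hx hy; apply: h; exact: ltnW.
congr (nat_of_bool (~~ _) + _); apply/mapP/mapP=> -[x].
  by rewrite mem_iota /= => hx e; exists x; rewrite ?mem_iota //; apply/h => //; exact: ltnW.
by rewrite mem_iota /= => hx e; exists x; rewrite ?mem_iota //; apply/h => //; exact: ltnW.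
Qed.

Lemma comps_ncard (T : eqType) n S (r : nat -> T) :
  (forall x y, x < n -> y < n -> (conn S x y <-> r x = r y)) -> comps n S = ncard n r.
Proof. by move=> h; apply: ncard_eq => x y hx hy; rewrite -h // labelP. Qed.

Lemma comps_eq n S S' :
  (forall x y, x < n -> y < n -> (conn S x y <-> conn S' x y)) -> comps n S = comps n S'.
Proof. by move=> h; apply: comps_ncard => x y hx hy; rewrite h // labelP. Qed.

Lemma comps_ext n S S' : adj S =2 adj S' -> comps n S = comps n S'.
Proof. by move=> h; apply: comps_eq => x y _ _; split; apply: conn_sub => u v; rewrite h. Qed.

Lemma comps_isolated n S : ends_below n S -> comps n.+1 S = (comps n S).+1.
Proof.
move=> bS; rewrite /comps ncardS; case: (boolP (_ \notin _)) => // /negPn /mapP [x].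
rewrite mem_iota /= => hx /labelP [[|z p]] /=; first by move=> _ e; rewrite e ltnn in hx.
by case/andP=> /(adj_below bS) /andP []; rewrite ltnn.
Qed.

Lemma comps_absorb n S S' x : x < n -> conn S n x ->
  (forall u v, u < n -> v < n -> (conn S u v <-> conn S' u v)) ->
  comps n.+1 S = comps n S'.
Proof.
move=> hx /labelP nx h; rewrite /comps ncardS.
have -> : label S n \in [seq label S z | z <- iota 0 n].
  by apply/mapP; exists x; rewrite ?mem_iota.
by rewrite add0n; exact: comps_eq.
Qed.

Lemma ltn_neqF u n : u < n -> (u == n) = false.
Proof. by move=> h; rewrite ltn_eqF. Qed.

(** Sending [n] to [x] contracts the pendant edge, so that edge links no two old vertices that [S]
    leaves apart. *)
Lemma comps_pendant n S x : ends_below n S -> x < n -> comps n.+1 ((x, n) :: S) = comps n S.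
Proof.
move=> bS hx; apply: (comps_absorb hx).
  by apply: conn_adj; rewrite /= joinsC joins_id.
move=> u v hu hv; split; last exact: conn_cons.
move/(@conn_lift (fun z => if z == n then x else z) _ S).
rewrite !ltn_neqF //; apply=> {u v hu hv} u v /= /orP [/joinsP /= |h].
  by case=> [[<- <-]|[<- <-]]; rewrite eqxx ltn_neqF //; exact: conn_refl.
have /andP [hu hv] := adj_below bS h; rewrite !ltn_neqF //; exact: conn_adj.
Qed.

(** Sending [n] to [y] contracts one half and turns the other into [(x, y)]; conversely the route
    through [n] replaces [(x, y)]. *)
Lemma comps_series n S x y : ends_below n S -> x < n -> y < n ->
  comps n.+1 ((x, n) :: (n, y) :: S) = comps n ((x, y) :: S).
Proof.
move=> bS hx hy; apply: (comps_absorb hx).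
  by apply: conn_adj; rewrite /= joinsC joins_id.
move=> u v hu hv; split.
  move/(@conn_lift (fun z => if z == n then y else z) _ ((x, y) :: S)).
  rewrite !ltn_neqF //; apply=> {u v hu hv} u v /= /or3P [/joinsP /= |/joinsP /= |h].
  - case=> [[<- <-]|[<- <-]]; rewrite eqxx ltn_neqF //; apply: conn_adj => /=.
      by rewrite joins_id.
    by rewrite joinsC joins_id.
  - by case=> [[<- <-]|[<- <-]]; rewrite eqxx ltn_neqF //; exact: conn_refl.
  have /andP [hu hv] := adj_below bS h; rewrite !ltn_neqF //.
  by apply: conn_cons; exact: conn_adj.
apply: (@conn_lift id) => {u v hu hv} u v /= /orP [/joinsP /= h|h].
  have xy : conn ((x, n) :: (n, y) :: S) x y.
    by apply: (@conn_trans _ n); apply: conn_adj; rewrite /= ?joins_id ?orbT.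
  by case: h => -[<- <-] //; exact: conn_sym.
by apply: conn_cons; apply: conn_cons; exact: conn_adj.
Qed.

(** The merge removes the label of [x] from the set of labels and keeps all the others. *)
Lemma comps_join n S x y : x < n -> y < n -> ~ conn S x y ->
  (comps n ((x, y) :: S)).+1 = comps n S.
Proof.
move=> hx hy nxy; rewrite /comps /ncard /=; set r := label S.
have rxy : r x <> r y by move/labelP.
pose m := merge r x y.
have memm z : (z \in [seq m i | i <- iota 0 n]) = (z != r x) && (z \in [seq r i | i <- iota 0 n]).
  apply/mapP/andP => [[i]|[zx /mapP [i hi ez]]].
    rewrite mem_iota /= /m /merge => hi; case: ifP => [_ ->|/negbT ix ->].
      split; first by apply/eqP => h; exact: rxy.
      by apply/mapP; exists y; rewrite ?mem_iota.
    by split=> //; apply/mapP; exists i; rewrite ?mem_iota.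
  by exists i; rewrite // /m /merge -ez (negbTE zx).
have -> : [seq merge r x y i | i <- iota 0 n] = [seq m i | i <- iota 0 n] by [].
apply: (@perm_size _ (r x :: undup [seq m i | i <- iota 0 n])).
apply: uniq_perm; rewrite ?undup_uniq //=.
  by rewrite undup_uniq mem_undup memm eqxx.
move=> z; rewrite inE !mem_undup memm; case: eqP => //= ->.
by apply/esym/mapP; exists x; rewrite ?mem_iota.
Qed.

(** An injection of the vertices below [n] into themselves is a permutation, so both sides count the
    same set of labels. *)
Lemma comps_relabel n (f : nat -> nat) S S' :
  (forall x, x < n -> f x < n) -> {in [pred x | x < n] &, injective f} ->
  (forall x y, x < n -> y < n -> (conn S' x y <-> conn S (f x) (f y))) ->
  comps n S' = comps n S.
Proof.
move=> fn finj h; rewrite (@comps_ncard _ n S' (label S \o f)); last first.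
  by move=> x y hx hy; rewrite h // labelP.
rewrite /comps /ncard.
have -> : [seq (label S \o f) x | x <- iota 0 n] =
    [seq label S x | x <- [seq f x | x <- iota 0 n]] by rewrite -map_comp.
apply: perm_size; apply: perm_undup; apply: eq_mem_map.
have [||| _ //] := @uniq_min_size _ [seq f x | x <- iota 0 n] (iota 0 n).
- rewrite map_inj_in_uniq ?iota_uniq // => x y; rewrite !mem_iota /=; exact: finj.
- by move=> z /mapP [x]; rewrite !mem_iota /= => hx ->; exact: fn.
by rewrite size_map.
Qed.

(** The component roots serve as labels; [insub] extends them to all of [nat], and the value [None]
    is never met below [nv G]. *)
Lemma ncomp_comps (G : mgraph) (A : {set 'I_(ne G)}) : wf_graph G ->
  ncomp A = comps (nv G) [seq endp G i | i : 'I_(ne G) <- enum A].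
Proof.
move=> wfG; set S := map _ _.
have bS : ends_below (nv G) S.
  apply/allP=> _ /mapP [i _ ->]; exact: (allP wfG _ (mem_nth _ (ltn_ord i))).
have adjE (x y : 'I_(nv G)) : adjA A x y = adj S x y.
  apply/existsP/hasP => [[i /andP [iA h]]|[_ /mapP [i iA ->] h]].
    exists (endp G i); first by apply/mapP; exists i; rewrite ?mem_enum.
    by case/orP: h => /andP [/eqP h1 /eqP h2]; apply/joinsP; rewrite h1 h2; auto.
  exists i; rewrite -mem_enum iA /=.
  by case/joinsP: h => [[-> ->]|[-> ->]]; rewrite !eqxx ?orbT.
have symA : connect_sym (adjA A).
  by apply: sym_connect_sym => x y; rewrite !adjE adjC.
have connE (x y : 'I_(nv G)) : conn S x y <-> connect (adjA A) x y.
  split=> [[p]|/connectP [p]].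
    elim: p x => [|z p IH] x /=; first by move=> _ /val_inj ->; exact: connect0.
    case/andP=> xz pz lz; have /andP [_ hz] := adj_below bS xz.
    apply: (@connect_trans _ _ (Ordinal hz)); last exact: IH.
    by apply: connect1; rewrite adjE.
  elim: p x => [|z p IH] x /=; first by move=> _ ->; exact: conn_refl.
  case/andP=> xz pz lz; apply: conn_trans (IH _ pz lz).
  by apply: conn_adj; rewrite -adjE.
pose r x : option 'I_(nv G) := omap (root (adjA A)) (insub x).
rewrite (@comps_ncard _ _ _ r); last first.
  move=> x y hx hy; rewrite /r !insubT /=.
  rewrite -[x]/(val (Ordinal hx)) -[y]/(val (Ordinal hy)) connE -root_connect //=.
  by split=> [/eqP ->|[->]].
rewrite /ncard -val_enum_ord -map_comp.
have -> : [seq (r \o val) x | x <- enum 'I_(nv G)] =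
    [seq Some x | x <- [seq root (adjA A) x | x <- enum 'I_(nv G)]].
  by rewrite -map_comp; apply: eq_map => x /=; rewrite /r valK.
rewrite undup_map_inj ?size_map; last by move=> ? ? [].
rewrite /ncomp /n_comp_mem cardE; apply: perm_size; apply: uniq_perm.
- exact: enum_uniq.
- exact: undup_uniq.
move=> x; rewrite mem_undup mem_enum !inE andbT.
apply/idP/mapP => [/eqP e|[y _ ->]]; first by exists x; rewrite ?mem_enum.
by rewrite /= roots_root.
Qed.

(** * Series, parallel and forest identities *)

Record wedge := Wedge { src : nat; tgt : nat; cap : nat; wout : cplx; win : cplx }.
Definition ends (e : wedge) : nat * nat := (src e, tgt e).

(** [S] collects the edges already chosen to be present, so the recursion runs over all subsets of
    [es] without forming them. *)
Fixpoint Zlist (q : cplx) (n : nat) (es : seq wedge) (S : seq (nat * nat)) : cplx :=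
  if es is e :: es' then
    Cadd (Cmul (wout e) (Zlist q n es' S)) (Cmul (win e) (Zlist q n es' (ends e :: S)))
  else Cpow q (comps n S).

(** The absent weight gathers the three states that do not link [x] to [y]; its factor [q] is the
    isolated middle vertex. Capacity [1] can only lower the flow, and it is the capacity at which
    transmissivity [rho^2] is allowed. *)
Definition series_edge q x y (e1 e2 : wedge) : wedge :=
  Wedge x y 1
    (Cadd (Cmul q (Cmul (wout e1) (wout e2)))
       (Cadd (Cmul (wout e1) (win e2)) (Cmul (win e1) (wout e2))))
    (Cmul (win e1) (win e2)).

Definition parallel_edge (e1 e2 : wedge) : wedge :=
  Wedge (src e1) (tgt e1) (cap e1 + cap e2) (Cmul (wout e1) (wout e2))
    (Cadd (Cadd (Cmul (wout e1) (win e2)) (Cmul (win e1) (wout e2)))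
       (Cmul (win e1) (win e2))).

(** The denominator of the transmissivity; [q] times it is [Z] of the edge alone on its two ends. *)
Definition trans_den q (e : wedge) : cplx := Cadd (Cmul q (wout e)) (win e).

Lemma Zlist_ext q n es S S' : adj S =2 adj S' -> Zlist q n es S = Zlist q n es S'.
Proof.
elim: es S S' => [|e es IH] S S' h /=; first by rewrite (comps_ext n h).
by congr Cadd; congr Cmul; apply: IH => // u v; rewrite /= h.
Qed.

Lemma Zlist_perm q n es es' S : Permutation es es' -> Zlist q n es S = Zlist q n es' S.
Proof.
move=> p; elim: p S => //= [e s s' _ IH S|e e' s S|s1 s2 s3 _ IH1 _ IH2 S].
- by rewrite !IH.
- rewrite (@Zlist_ext _ _ _ (ends e :: ends e' :: S) (ends e' :: ends e :: S)); first by ring.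
  by move=> u v /=; rewrite orbCA.
by rewrite IH1.
Qed.

Lemma Zlist_parallel q n e1 e2 es S : ends e1 = ends e2 ->
  Zlist q n (e1 :: e2 :: es) S = Zlist q n (parallel_edge e1 e2 :: es) S.
Proof.
move=> e12 /=; rewrite -e12 /ends /=.
rewrite (@Zlist_ext _ _ es [:: _, _ & _] ((src e1, tgt e1) :: S)); first by ring.
by move=> u v /=; rewrite orbA orbb.
Qed.

Lemma Zlist_isolated q n es S : ends_below n [seq ends e | e <- es] -> ends_below n S ->
  Zlist q n.+1 es S = Cmul q (Zlist q n es S).
Proof.
elim: es S => [|e es IH] S /=; first by move=> _ /comps_isolated ->.
case/andP=> be bes bS; rewrite !IH //=; first by ring.
by rewrite be.
Qed.

Lemma Zlist_pendant q n es S x : ends_below n [seq ends e | e <- es] -> ends_below n S -> x < n ->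
  Zlist q n.+1 es ((x, n) :: S) = Zlist q n es S.
Proof.
move=> + + hx; elim: es S => [|e es IH] S /=; first by move=> _ /comps_pendant ->.
case/andP=> be bes bS; rewrite IH //; congr Cadd; congr Cmul.
rewrite -IH //=; last by rewrite be.
by apply: Zlist_ext => u v /=; rewrite orbCA.
Qed.

Lemma Zlist_subdivided q n es S x y : ends_below n [seq ends e | e <- es] -> ends_below n S ->
  x < n -> y < n ->
  Zlist q n.+1 es ((x, n) :: (n, y) :: S) = Zlist q n es ((x, y) :: S).
Proof.
move=> + + hx hy; elim: es S => [|e es IH] S /=; first by move=> _ bS; rewrite comps_series.
case/andP=> be bes bS; rewrite IH //; congr Cadd; congr Cmul.
rewrite (@Zlist_ext _ n _ [:: ends e, (x, y) & S] [:: (x, y), ends e & S]); last first.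
  by move=> u v /=; rewrite orbCA.
rewrite -IH //=; last by rewrite be.
by apply: Zlist_ext => u v /=; case: (joins (ends e) u v); rewrite ?orbT.
Qed.

(** The four states of the two edges leave [n] isolated, pendant at [y], pendant at [x], or
    subdividing an edge from [x] to [y]; each reduces to a sum on [n] vertices. *)
Lemma Zlist_series q n e1 e2 es x y : ends_below n [seq ends e | e <- es] ->
  x < n -> y < n -> ends e1 = (x, n) -> ends e2 = (n, y) ->
  Zlist q n.+1 (e1 :: e2 :: es) [::] = Zlist q n (series_edge q x y e1 e2 :: es) [::].
Proof.
move=> bes hx hy h1 h2 /=; rewrite h1 h2 Zlist_isolated // Zlist_pendant //.
rewrite (@Zlist_ext _ n.+1 _ [:: (n, y)] [:: (y, n)]); last first.
  by move=> u v /=; rewrite joins_swap.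
rewrite Zlist_pendant //.
rewrite (@Zlist_ext _ _ _ [:: (n, y); (x, n)] [:: (x, n); (n, y)]); last first.
  by move=> u v /=; rewrite !orbF orbC.
rewrite Zlist_subdivided // [ends (series_edge _ _ _ _ _)]/ends /=; ring.
Qed.

(* The power of [q] stands on the left so that no division by [q] occurs. *)
Lemma Zlist_forest q n es S : ends_below n [seq ends e | e <- es] ->
  (forall e r, Permutation ([seq ends e | e <- es] ++ S) (e :: r) -> ~ conn r e.1 e.2) ->
  Cmul (Cpow q (size es)) (Zlist q n es S) =
  Cmul (Cpow q (comps n S)) (foldr Cmul Cone [seq trans_den q e | e <- es]).
Proof.
elim: es S => [|e es IH] S /=; first by move=> _ _; ring.
case/andP=> /andP [hx hy] bes bridge.
have eS : ~ conn S (src e) (tgt e).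
  move=> h; apply: (bridge (ends e) _ (Permutation_refl _)).
  by apply: conn_sub h => u v /= h; rewrite /adj has_cat -/(adj S u v) h orbT.
(* [S] has one component more than [ends e :: S]; this extra power of [q] is what combines the two
   branches into the factor [q * wout e + win e]. *)
have E1 := IH S bes _; rewrite -(comps_join hx hy eS) /= in E1 *.
have E2 := IH (ends e :: S) bes _.
set Z1 := Zlist q n es S in E1 *; set Z2 := Zlist q n es _ in E2 *.
set P := foldr _ _ _ in E1 E2 *.
have -> : Cmul (Cmul q (Cpow q (size es)))
    (Cadd (Cmul (wout e) Z1) (Cmul (win e) Z2)) =
  Cadd (Cmul q (Cmul (wout e) (Cmul (Cpow q (size es)) Z1)))
    (Cmul q (Cmul (win e) (Cmul (Cpow q (size es)) Z2))) by ring.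
rewrite E1 ?E2 /trans_den; first by rewrite /ends; ring.
- move=> e' r p; apply: bridge; apply: Permutation_trans p.
  exact: Permutation_middle.
move=> e' r p h; apply: (bridge e' (ends e :: r)); last exact: conn_cons.
by apply: Permutation_trans (perm_skip _ p) (perm_swap _ _ _).
Qed.

Lemma foldr_Cmul_neq0 (T : Type) (F : T -> cplx) (s : seq T) :
  List.Forall (fun x => F x <> Czero) s -> foldr Cmul Cone [seq F x | x <- s] <> Czero.
Proof.
elim=> [|x l h _ IH] /=; last exact: Cmul_neq0.
by move=> [] /R1_neq_R0.
Qed.

(** * The subset sum [ZG] as a recursion over edges *)

HB.instance Definition _ := Monoid.isComLaw.Build cplx Czero Cadd
  (Radd_assoc cplx_ring) (Radd_comm cplx_ring) (Radd_0_l cplx_ring).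

HB.instance Definition _ := Monoid.isComLaw.Build cplx Cone Cmul
  (Rmul_assoc cplx_ring) (Rmul_comm cplx_ring) (Rmul_1_l cplx_ring).

Lemma sum_subsetsU1 (T : finType) (x : T) (S : {set T}) (F : {set T} -> cplx) : x \notin S ->
  \big[Cadd/Czero]_(A : {set T} | A \subset x |: S) F A =
  Cadd (\big[Cadd/Czero]_(A : {set T} | A \subset S) F A)
    (\big[Cadd/Czero]_(A : {set T} | A \subset S) F (x |: A)).
Proof.
move=> xS; rewrite (bigID (fun A : {set T} => x \in A)) /= [LHS]Radd_comm //; last exact: cplx_ring.
congr Cadd.
  apply: eq_bigl => A; apply/andP/idP => [[/subsetP AS xA]|AS].
    apply/subsetP => y yA; have := AS y yA; rewrite !inE => /orP [/eqP e|//].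
    by rewrite -e yA in xA.
  by split; [apply: subset_trans AS (subsetUr _ _) | apply: contra xS; exact: (subsetP AS)].
rewrite (reindex_onto (fun A => x |: A) (fun A => A :\ x)) /=; last first.
  by move=> A /andP [_ xA]; rewrite setD1K.
apply: eq_bigl => A; rewrite setU11 andbT.
apply/andP/idP => [[/subsetP AS /eqP e]|AS].
  apply/subsetP => y yA; have := AS y; rewrite !inE yA orbT => /(_ isT) /orP [/eqP yx|//].
  by move: yA; rewrite -e yx !inE eqxx.
split; first exact: setUS.
by rewrite setU1K //; apply: contra xS; exact: (subsetP AS).
Qed.

Definition unit_wedge (G : mgraph) (v : 'I_(ne G) -> cplx) (i : 'I_(ne G)) : wedge :=
  Wedge (endp G i).1 (endp G i).2 1 Cone (v i).

Lemma ends_unit_wedge (G : mgraph) (v : 'I_(ne G) -> cplx) i :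
  ends (unit_wedge v i) = endp G i.
Proof. by rewrite /ends /=; case: (endp G i). Qed.

(** The set [B] of edges already present is matched to [S] only through [adj], so the induction can
    add an edge to both without regard to order. *)
Lemma Zlist_subsets (G : mgraph) q (v : 'I_(ne G) -> cplx) (s : seq 'I_(ne G))
    (B : {set 'I_(ne G)}) S :
  wf_graph G -> uniq s -> adj S =2 adj [seq endp G i | i : 'I_(ne G) <- enum B] ->
  Zlist q (nv G) [seq unit_wedge v i | i <- s] S =
  \big[Cadd/Czero]_(A : {set 'I_(ne G)} | A \subset [set i in s])
    Cmul (Cpow q (ncomp (A :|: B))) (\big[Cmul/Cone]_(i in A) v i).
Proof.
move=> wfG; elim: s B S => [|x s IH] B S /=.
  move=> _ h; rewrite (big_pred1 set0) => [|A]; last first.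
    by rewrite set_nil subset0.
  rewrite set0U big_set0 ncomp_comps // (comps_ext _ h).
  by rewrite (Rmul_comm cplx_ring) (Rmul_1_l cplx_ring).
case/andP=> xs us h; rewrite set_cons sum_subsetsU1 ?inE //.
rewrite (IH B) // (IH (x |: B)) //; last first.
  move=> u v0 /=; rewrite h ends_unit_wedge; apply/orP/hasP => [[j|/hasP [e /mapP [i iB ->] j]]|[e /mapP [i]]].
  - exists (endp G x) => //.
    by apply/mapP; exists x; rewrite // mem_enum setU11.
  - by exists (endp G i) => //; apply/mapP; exists i; rewrite // mem_enum !inE -[i \in B]mem_enum iB orbT.
  rewrite mem_enum !inE => /orP [/eqP -> -> j|iB -> j].
    by left.
  by right; apply/hasP; exists (endp G i) => //; apply/mapP; exists i; rewrite ?mem_enum.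
congr Cadd; first by rewrite Rmul_1_l //; exact: cplx_ring.
rewrite (big_morph (Cmul (v x)) (id1 := Czero) (op1 := Cadd)); [|by move=> a b; ring|by ring].
apply: eq_bigr => A As.
have xA : x \notin A by apply: contra xs => /(subsetP As); rewrite inE.
rewrite big_setU1 //= setUCA setUA !(Rmul_assoc cplx_ring); congr Cmul.
exact: (Rmul_comm cplx_ring).
Qed.

Lemma ZG_Zlist (G : mgraph) q (v : 'I_(ne G) -> cplx) : wf_graph G ->
  ZG G q v = Zlist q (nv G) [seq unit_wedge v i | i <- enum 'I_(ne G)] [::].
Proof.
move=> wfG; rewrite (@Zlist_subsets _ _ _ _ set0) ?enum_uniq //; last first.
  by move=> u w; rewrite enum_set0.
rewrite /ZG foldrE big_map big_enum /=.
apply: eq_big => [A|A _].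
  by rewrite inE; apply/esym/subsetP => i _; rewrite !inE mem_enum.
by rewrite setU0 foldrE big_map big_enum.
Qed.

Lemma map_ends_unit_wedge (G : mgraph) (v : 'I_(ne G) -> cplx) :
  [seq ends e | e <- [seq unit_wedge v i | i <- enum 'I_(ne G)]] = edges G.
Proof.
rewrite -map_comp; apply: (@eq_from_nth _ (0, 0)); first by rewrite size_map size_enum_ord.
move=> i; rewrite size_map size_enum_ord => hi.
rewrite (nth_map (Ordinal hi)) ?size_enum_ord //= -[RHS]/(endp G i).
by rewrite ends_unit_wedge nth_enum_ord.
Qed.

(** * Flows *)

Fixpoint steps (x : nat) (p : seq nat) : seq (nat * nat) :=
  if p is y :: p' then (x, y) :: steps y p' else [::].

Definition vpath (n x y : nat) (p : seq nat) : bool :=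
  [&& all (fun z => z < n) (x :: p), last x p == y & uniq (x :: p)].

Definition usage (x : nat) (P : seq (seq nat)) (u v : nat) : nat :=
  count (fun e => joins e u v) (flatten [seq steps x p | p <- P]).

Definition capacity (es : seq wedge) (u v : nat) : nat :=
  sumn [seq joins (ends e) u v * cap e | e <- es].

(* A path family respecting the capacities models [cap e] parallel copies of every edge [e];
   only the total capacity between two vertices matters. *)
Definition flow_le (n : nat) (es : seq wedge) (L : nat) : Prop :=
  forall x y P, x < n -> y < n -> x != y -> all (vpath n x y) P ->
    (forall u v, usage x P u v <= capacity es u v) -> size P <= L.

Definition proper_edge (n : nat) (e : wedge) : bool :=
  [&& src e < n, tgt e < n, src e != tgt e & 0 < cap e].

Lemma proper_below n es : all (proper_edge n) es -> ends_below n [seq ends e | e <- es].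
Proof.
by move=> h; rewrite /ends_below all_map; apply: sub_all h => e /and4P [/= -> ->].
Qed.

Lemma steps_cat x p s : steps x (p ++ s) = steps x p ++ steps (last x p) s.
Proof. by elim: p x => //= y p IH x; rewrite IH. Qed.

Lemma steps_notin x p s u : u \notin x :: p -> count (fun e => joins e u s) (steps x p) = 0.
Proof.
elim: p x => //= y p IH x; rewrite inE negb_or => /andP [ux uyp].
rewrite IH // addn0; apply/eqP; rewrite eqb0; apply/joinsP => /=.
rewrite inE negb_or in uyp; case/andP: uyp => uy _.
by case=> -[h1 h2]; [rewrite h1 eqxx in ux | rewrite h2 eqxx in uy].
Qed.

Lemma count_steps_simple x p u v : uniq (x :: p) -> count (fun e => joins e u v) (steps x p) <= 1.
Proof.
elim: p x => //= y p IH x /andP [xyp up].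
have := IH y up; case: (joinsP (x, y) u v) => //= h _.
rewrite -[X in _ <= X]addn0 leq_add2l leqn0.
case: h => -[ex ey].
  by rewrite -ex; apply/eqP; exact: steps_notin.
rewrite (eq_count (fun e => joinsC e u v)) -ex; apply/eqP; exact: steps_notin.
Qed.

Lemma count_steps_adj S x p u v : uniq (x :: p) -> path (adj S) x p ->
  count (fun e => joins e u v) (steps x p) <= adj S u v.
Proof.
move=> up pp; case: (boolP (adj S u v)) => [_|nuv]; first exact: count_steps_simple.
move: pp; clear up; elim: p x => //= y p IH x /andP [xy /IH].
rewrite !leqn0 => /eqP ->; rewrite addn0 eqb0; apply: contra nuv => /joinsP /=.
by case=> [[<- <-]|[<- <-]] //; rewrite adjC.
Qed.

Lemma adj_capacity n es u v : all (proper_edge n) es ->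
  adj [seq ends e | e <- es] u v <= capacity es u v.
Proof.
elim: es => //= e es IH /andP [/and4P [_ _ _ ce] /IH]; rewrite /capacity /=.
by case: (joins _ u v) => /=; lia.
Qed.

Lemma conn_path n S x y : ends_below n S -> x < n -> conn S x y ->
  exists2 p, path (adj S) x p & vpath n x y p.
Proof.
move=> bS hx [p pp lp]; move: pp lp; case/shortenP => p' pp' up' _ lp.
exists p'; rewrite // /vpath lp eqxx up' /= hx !andbT.
elim: p' x {hx up' lp} pp' => //= z p' IH x /andP [xz /IH ->].
by case/andP: (adj_below bS xz) => _ ->.
Qed.

(** The edge taken [cap e] times, together with one path through the remaining edges, is a family of
    [cap e + 1] paths. *)
Lemma nonbridge_cap n e r L : flow_le n (e :: r) L -> all (proper_edge n) (e :: r) ->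
  conn [seq ends e | e <- r] (src e) (tgt e) -> cap e < L.
Proof.
move=> fl /= /andP [/and4P [hs ht hst hc] pr] cn.
have [p pp vp] := conn_path (proper_below pr) hs cn.
have := fl (src e) (tgt e) (rcons (nseq (cap e) [:: tgt e]) p) hs ht hst.
rewrite size_rcons size_nseq; apply.
  rewrite all_rcons vp all_nseq /vpath /= hs ht !inE hst eqxx; by rewrite orbT.
move=> u v; rewrite /usage map_rcons flatten_rcons count_cat /capacity /=.
apply: leq_add.
  rewrite map_nseq; elim: (cap e) => //= c IH; move: IH; rewrite /ends /=; lia.
apply: leq_trans (adj_capacity u v pr); apply: count_steps_adj => //.
by case/and3P: vp.
Qed.

Lemma capacity_perm es es' u v : Permutation es es' -> capacity es u v = capacity es' u v.
Proof.
rewrite /capacity; elim=> //= [e s s' _ -> //|e e' s|s1 s2 s3 _ -> _ -> //].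
by rewrite addnCA.
Qed.

Lemma flow_le_capacity n es es' L : (forall u v, capacity es' u v <= capacity es u v) ->
  flow_le n es L -> flow_le n es' L.
Proof.
by move=> h fl x y P hx hy xy vP us; apply: (fl x y) => // u v; apply: leq_trans (h u v).
Qed.

Lemma flow_le_parallel n e1 e2 es L : ends e1 = ends e2 ->
  flow_le n (e1 :: e2 :: es) L -> flow_le n (parallel_edge e1 e2 :: es) L.
Proof.
move=> e12; apply: flow_le_capacity => u v; rewrite /capacity /= -e12 /ends /=.
by rewrite mulnDr addnA.
Qed.

Lemma vpathS n x y p : vpath n x y p -> vpath n.+1 x y p.
Proof. by case/and3P=> h1 h2 h3; apply/and3P; split=> //; apply: sub_all h1 => z /ltnW. Qed.

Lemma steps_split s p x y : has (fun e => joins e x y) (steps s p) ->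
  exists p1 v p2, p = p1 ++ v :: p2 /\ joins (last s p1, v) x y.
Proof.
elim: p s => //= z p IH s /orP [h|/IH [p1 [v [p2 [-> h]]]]].
  by exists [::], z, p.
by exists (z :: p1), v, p2.
Qed.

Lemma joins_trans e x y u v : joins (x, y) u v -> joins e u v = joins e x y.
Proof. by case/joinsP => /= -[-> ->] //; exact: joinsC. Qed.

(** If some path steps between the ends of [e], rerouting one such step through [n] gives back the
    single unit of capacity of [e] and takes one unit from each half. If none does, the family fits
    unchanged. *)
Lemma flow_le_series n e1 e2 e es L : 0 < cap e1 -> 0 < cap e2 ->
  ends e1 = (src e, n) -> ends e2 = (n, tgt e) -> cap e = 1 ->
  flow_le n.+1 (e1 :: e2 :: es) L -> flow_le n (e :: es) L.
Proof.
move=> c1 c2 h1 h2 c12 fl s t P hs ht st vP us.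
set x := src e in h1; set y := tgt e in h2.
have us' u v : usage s P u v <= joins (x, y) u v + capacity es u v.
  by have := us u v; rewrite /capacity /= c12 muln1.
have cap' u v : joins (x, n) u v + joins (n, y) u v + capacity es u v <=
    capacity (e1 :: e2 :: es) u v.
  rewrite /capacity /= h1 h2; case: (joins _ u v); case: (joins _ u v) => /=; lia.
case: (boolP (has (fun p => has (fun e => joins e x y) (steps s p)) P)) => [|nP]; last first.
  apply: (fl s t) => //; [exact: ltnW | exact: ltnW | by apply: sub_all vP => p /vpathS |].
  move=> u v; apply: leq_trans (cap' u v); case: (boolP (joins (x, y) u v)) => xyuv; last first.
    by have := us' u v; rewrite (negbTE xyuv); lia.
  suff -> : usage s P u v = 0 by [].
  apply/eqP; rewrite /usage -leqn0 leqNgt -has_count.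
  apply: contra nP => /hasP [d /flattenP [_ /mapP [p pP ->] dp] duv].
  by apply/hasP; exists p => //; apply/hasP; exists d; rewrite // -(joins_trans _ xyuv).
case/hasP=> p pP /steps_split [p1 [v0 [p2 [ep jv]]]].
case/splitPr: pP vP us us' => P1 P2 vP us us'.
pose p' := p1 ++ n :: v0 :: p2.
have -> : size (P1 ++ p :: P2) = size (P1 ++ p' :: P2) by rewrite !size_cat.
move: vP; rewrite all_cat /= => /and3P [vP1 vp vP2].
apply: (fl s t) => //; [exact: ltnW | exact: ltnW | |].
  rewrite all_cat /=; apply/and3P; split.
  - by apply: sub_all vP1 => z /vpathS.
  - case/and3P: vp => ap lp up.
    have pp : perm_eq (s :: p') (n :: s :: p).
      by rewrite /p' ep -[s :: _]/((s :: p1) ++ [:: n] ++ (v0 :: p2)) perm_catCA.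
    apply/and3P; split.
    + rewrite (perm_all _ pp) /= ltnSn /=; apply: sub_all ap => z; exact: ltnW.
    + by move: lp; rewrite ep /p' !last_cat.
    rewrite (perm_uniq pp) cons_uniq up andbT; apply/negP => /(allP ap); by rewrite ltnn.
  - by apply: sub_all vP2 => z /vpathS.
move=> u v; apply: leq_trans (cap' u v).
have := us' u v; rewrite /usage !map_cat !flatten_cat /= !count_cat.
rewrite ep /p' !steps_cat /= !count_cat /=.
have : joins (last s p1, n) u v + joins (n, v0) u v = joins (x, n) u v + joins (n, y) u v.
  case/joinsP: jv => /= -[-> ->] //.
  by rewrite addnC [joins (n, x) _ _]joins_swap [joins (y, n) _ _]joins_swap.
have -> : joins (last s p1, v0) u v = joins (x, y) u v.
  by case/joinsP: jv => /= -[-> ->] //; exact: joins_swap.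
lia.
Qed.

(** * Transmissivity estimates *)

Local Open Scope R_scope.

(* [win e / trans_den q e] is the transmissivity, and the first disjunct is the weight
   [v = -1]. *)
Definition good (q : cplx) (rho X : R) (e : wedge) : Prop :=
  Cadd (wout e) (win e) = Czero \/
  Cnorm (win e) * (1 - rho * X ^ cap e) <= rho * (X ^ cap e - 1) * Cnorm (trans_den q e).

(** All that the estimates use about [q], [rho] and [X]. The fourth condition bounds the
    transmissivity by [rho] at every capacity below [L]; the last says that [rho^2] is allowed at
    capacity [1]. *)
Definition regime (L : nat) (q : cplx) (rho X : R) : Prop :=
  [/\ 0 < rho < 1, rho * Cnorm (Csub q Cone) = 1, 1 <= X,
      X ^ (L - 1) * (1 + rho) <= 2 & 1 + rho <= X * (1 + rho ^ 2)].

Lemma regime_pow L q rho X c : regime L q rho X -> (c < L)%N ->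
  [/\ 1 <= X ^ c, X ^ c * (1 + rho) <= 2 & 0 < 1 - rho * X ^ c].
Proof.
move=> [hr _ hX hXL _] hc.
have h1 : 1 <= X ^ c by apply: pow_R1_Rle.
have h2 : X ^ c <= X ^ (L - 1) by apply: Rle_pow => //; lia.
have h3 : X ^ c * (1 + rho) <= 2 by nra.
split=> //; nra.
Qed.

Lemma regime_q_neq0 L q rho X : regime L q rho X -> q <> Czero.
Proof.
move=> [hr h _ _ _] q0; move: h.
have -> : Csub q Cone = Copp Cone by rewrite q0; ring.
rewrite CnormN Cnorm1; lra.
Qed.

(** For [v = -1] the transmissivity is [-1 / (q - 1)], of modulus exactly [rho]; otherwise
    [X^c - 1 <= 1 - rho * X^c] by the regime. *)
Lemma good_le L q rho X e : regime L q rho X -> (cap e < L)%N -> good q rho X e ->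
  Cnorm (win e) <= rho * Cnorm (trans_den q e).
Proof.
move=> reg hc; have [h1 h2 h3] := regime_pow reg hc; case: reg => hr hq _ _ _ [h|h].
  have -> : trans_den q e = Copp (Cmul (Csub q Cone) (win e)).
    transitivity (Csub (Cmul q (Cadd (wout e) (win e))) (Cmul (Csub q Cone) (win e))).
      rewrite /trans_den; ring.
    rewrite h; ring.
  rewrite CnormN CnormM -Rmult_assoc hq; lra.
have := Cnorm_ge0 (trans_den q e) => h0.
apply: (Rmult_le_reg_r (1 - rho * X ^ cap e)) => //.
apply: Rle_trans h _.
have : 0 <= (1 - rho * X ^ cap e) - (X ^ cap e - 1) by lra.
have : 0 <= rho * Cnorm (trans_den q e) by nra.
nra.
Qed.

Lemma trans_den_series q x y e1 e2 :
  trans_den q (series_edge q x y e1 e2) = Cmul (trans_den q e1) (trans_den q e2).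
Proof. rewrite /trans_den /=; ring. Qed.

Lemma good_series L q rho X x y e1 e2 : regime L q rho X ->
  (cap e1 < L)%N -> (cap e2 < L)%N -> good q rho X e1 -> good q rho X e2 ->
  good q rho X (series_edge q x y e1 e2).
Proof.
move=> reg hc1 hc2 /(good_le reg hc1) g1 /(good_le reg hc2) g2; right.
rewrite trans_den_series /= !CnormM Rmult_1_r.
have h1 := Cnorm_ge0 (win e1); have h2 := Cnorm_ge0 (win e2).
have h3 := Cnorm_ge0 (trans_den q e1); have h4 := Cnorm_ge0 (trans_den q e2).
move: g1 g2 h1 h2 h3 h4; set b1 := Cnorm (win e1); set b2 := Cnorm (win e2).
set p1 := Cnorm (trans_den _ _); set p2 := Cnorm (trans_den _ _) => g1 g2 h1 h2 h3 h4.
have g12 : b1 * b2 <= rho ^ 2 * (p1 * p2).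
  have := Rmult_le_compat _ _ _ _ h1 h2 g1 g2; lra.
case: reg => hr _ hX _ hX2.
have p12 : 0 <= p1 * p2 by nra.
have hX3 : rho * (1 - rho * X) <= X - 1 by lra.
have b12 : 0 <= b1 * b2 by nra.
(* For negative [1 - rho * X] the two sides are separated by [0]; otherwise [g12] may be multiplied
   by it. *)
case: (Rle_lt_dec 0 (1 - rho * X)) => hd; last first.
  apply: Rle_trans (_ : 0 <= _); first by nra.
  apply: Rmult_le_pos => //; nra.
apply: Rle_trans (_ : rho ^ 2 * (p1 * p2) * (1 - rho * X) <= _); first nra.
have : 0 <= rho * (p1 * p2) by nra.
nra.
Qed.

(** The factor [q] lets the parallel edge be written in [trans_den] and [win] of the two edges
    alone, which is where the triangle inequality applies. *)
Lemma trans_den_parallel q e1 e2 :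
  Cmul q (trans_den q (parallel_edge e1 e2)) =
  Cadd (Cmul (trans_den q e1) (trans_den q e2))
    (Cmul (Csub q Cone) (Cmul (win e1) (win e2))).
Proof. rewrite /trans_den /=; ring. Qed.

Lemma win_parallel q e1 e2 :
  Cmul q (win (parallel_edge e1 e2)) =
  Cadd (Cadd (Cmul (trans_den q e1) (win e2)) (Cmul (win e1) (trans_den q e2)))
    (Cadd (Cmul (Csub q Cone) (Cmul (win e1) (win e2))) (Copp (Cmul (win e1) (win e2)))).
Proof. rewrite /trans_den /=; ring. Qed.

Lemma trans_den_parallel_lb q rho e1 e2 : 0 < rho -> rho * Cnorm (Csub q Cone) = 1 ->
  Cnorm (trans_den q e1) * Cnorm (trans_den q e2) - Cnorm (win e1) * Cnorm (win e2) / rho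
  <= Cnorm (Cmul q (trans_den q (parallel_edge e1 e2))).
Proof.
move=> hr hq; rewrite trans_den_parallel.
set u := Cmul (trans_den _ _) _; set w := Cmul _ (Cmul _ _).
have := CnormD (Cadd u w) (Copp w).
have -> : Cadd (Cadd u w) (Copp w) = u by ring.
rewrite CnormN !CnormM.
have -> : Cnorm (Csub q Cone) = / rho by apply: (Rmult_eq_reg_l rho); [rewrite hq; field|]; lra.
rewrite /Rdiv; lra.
Qed.

(** Both transmissivities are at most [rho], so the lower bound is at least [1 - rho] times the
    product of the two denominators. *)
Lemma trans_den_parallel_neq0 L q rho X e1 e2 : regime L q rho X ->
  (cap e1 < L)%N -> (cap e2 < L)%N -> good q rho X e1 -> good q rho X e2 ->
  trans_den q e1 <> Czero -> trans_den q e2 <> Czero ->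
  trans_den q (parallel_edge e1 e2) <> Czero.
Proof.
move=> reg hc1 hc2 /(good_le reg hc1) g1 /(good_le reg hc2) g2 /Cnorm_gt0 p1 /Cnorm_gt0 p2 e0.
case: reg => hr hq _ _ _.
have := @trans_den_parallel_lb q rho e1 e2 ltac:(lra) hq.
rewrite e0 CnormM Cnorm0 Rmult_0_r.
have := Rmult_le_compat _ _ _ _ (Cnorm_ge0 _) (Cnorm_ge0 _) g1 g2.
move: p1 p2; set p1 := Cnorm (trans_den q e1); set p2 := Cnorm (trans_den q e2).
set b := Cnorm (win e1) * _ => h1 h2 hb hle.
have p12 : 0 < p1 * p2 by nra.
have : b / rho <= rho * (p1 * p2).
  apply: (Rmult_le_reg_r rho); first lra. rewrite /Rdiv Rmult_assoc Rinv_l; lra.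
nra.
Qed.

(* Equality holds for [t_i = rho (Y_i - 1) / (1 - rho Y_i)]. *)
Lemma parallel_bound rho Y1 Y2 t1 t2 : 0 < rho < 1 -> 1 <= Y1 -> 1 <= Y2 ->
  0 < 1 - rho * (Y1 * Y2) -> 0 <= t1 -> 0 <= t2 ->
  t1 * (1 - rho * Y1) <= rho * (Y1 - 1) -> t2 * (1 - rho * Y2) <= rho * (Y2 - 1) ->
  (t1 + t2 + (/ rho + 1) * (t1 * t2)) * (1 - rho * (Y1 * Y2)) <=
  rho * (Y1 * Y2 - 1) * (1 - t1 * t2 / rho).
Proof.
move=> hr hY1 hY2 hd ht1 ht2 h1 h2.
have d1 : 0 < 1 - rho * Y1 by nra.
have d2 : 0 < 1 - rho * Y2 by nra.
pose r1 := rho * (Y1 - 1) / (1 - rho * Y1); pose r2 := rho * (Y2 - 1) / (1 - rho * Y2).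
have le1 : t1 <= r1.
  apply: (Rmult_le_reg_r (1 - rho * Y1)) => //; rewrite /r1; field_simplify; lra.
have le2 : t2 <= r2.
  apply: (Rmult_le_reg_r (1 - rho * Y2)) => //; rewrite /r2; field_simplify; lra.
have le12 : t1 * t2 <= r1 * r2 by exact: Rmult_le_compat.
have ir : 0 < / rho by apply: Rinv_0_lt_compat; lra.
have hY : 1 <= Y1 * Y2 by nra.
apply: Rle_trans (_ : (r1 + r2 + (/ rho + 1) * (r1 * r2)) * (1 - rho * (Y1 * Y2)) <= _).
  apply: Rmult_le_compat_r; first lra.
  have : (/ rho + 1) * (t1 * t2) <= (/ rho + 1) * (r1 * r2) by apply: Rmult_le_compat_l; lra.
  lra.
apply: Rle_trans (_ : rho * (Y1 * Y2 - 1) * (1 - r1 * r2 / rho) <= _).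
  apply: Req_le; rewrite /r1 /r2; field; lra.
apply: Rmult_le_compat_l; first by nra.
have : t1 * t2 * / rho <= r1 * r2 * / rho by apply: Rmult_le_compat_r; lra.
rewrite /Rdiv; lra.
Qed.

(** The sums [wout + win] multiply, so one edge with [v = -1] gives the combined edge [v = -1].
    Otherwise [parallel_bound] is applied to the two moduli of transmissivity and scaled back by the
    denominators. *)
Lemma good_parallel L q rho X e1 e2 : regime L q rho X -> (cap e1 + cap e2 < L)%N ->
  good q rho X e1 -> good q rho X e2 ->
  trans_den q e1 <> Czero -> trans_den q e2 <> Czero ->
  good q rho X (parallel_edge e1 e2).
Proof.
move=> reg hc g1 g2 /Cnorm_gt0 p1 /Cnorm_gt0 p2.
have abE : Cadd (wout (parallel_edge e1 e2)) (win (parallel_edge e1 e2)) =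
  Cmul (Cadd (wout e1) (win e1)) (Cadd (wout e2) (win e2)) by rewrite /=; ring.
case: g1 => [g1|g1]; first by left; rewrite abE g1; ring.
case: g2 => [g2|g2]; first by left; rewrite abE g2; ring.
right; rewrite [cap _]/=.
have q0 := Cnorm_gt0 (regime_q_neq0 reg).
have [y1 _ _] := regime_pow reg (leq_ltn_trans (leq_addr _ _) hc).
have [y2 _ _] := regime_pow reg (leq_ltn_trans (leq_addl _ _) hc).
have [y12 _ d12] := regime_pow reg hc.
rewrite pow_add in y12 d12 *.
case: reg => hr hq _ _ _.
have lb := @trans_den_parallel_lb q rho e1 e2 ltac:(lra) hq.
have ub : Cnorm (Cmul q (win (parallel_edge e1 e2))) <=
   Cnorm (trans_den q e1) * Cnorm (win e2) + Cnorm (win e1) * Cnorm (trans_den q e2) +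
   (/ rho + 1) * (Cnorm (win e1) * Cnorm (win e2)).
  rewrite (win_parallel q).
  apply: Rle_trans (CnormD _ _) _; apply: Rplus_le_compat.
    by apply: Rle_trans (CnormD _ _) _; rewrite !CnormM; lra.
  apply: Rle_trans (CnormD _ _) _; rewrite CnormN !CnormM.
  have -> : Cnorm (Csub q Cone) = / rho by apply: (Rmult_eq_reg_l rho); [rewrite hq; field|]; lra.
  lra.
rewrite !CnormM in lb ub.
have b1 := Cnorm_ge0 (win e1); have b2 := Cnorm_ge0 (win e2).
move: p1 p2 b1 b2 g1 g2 lb ub.
set P1 := Cnorm (trans_den q e1); set P2 := Cnorm (trans_den q e2).
set B1 := Cnorm (win e1); set B2 := Cnorm (win e2).
set Y1 := X ^ _ in y1 y12 d12 *; set Y2 := X ^ _ in y2 y12 d12 *.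
set Q := Cnorm q in q0 *; set P := Cnorm _; set B := Cnorm _.
move=> p1 p2 b1 b2 g1 g2 lb ub.
have i1 := Rinv_0_lt_compat _ p1; have i2 := Rinv_0_lt_compat _ p2.
have e1' : B1 = B1 / P1 * P1 by field; lra.
have e2' : B2 = B2 / P2 * P2 by field; lra.
have key := @parallel_bound rho Y1 Y2 (B1 / P1) (B2 / P2) hr y1 y2 d12.
have {}key := key ltac:(apply: Rmult_le_pos; lra) ltac:(apply: Rmult_le_pos; lra).
have {}key := key ltac:(apply: (Rmult_le_reg_r P1) => //; rewrite {1}e1' in g1; lra).
have {}key := key ltac:(apply: (Rmult_le_reg_r P2) => //; rewrite {1}e2' in g2; lra).
move: key e1' e2'; set t1 := B1 / P1; set t2 := B2 / P2 => key e1' e2'.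
rewrite e1' e2' in lb ub.
have p12 : 0 < P1 * P2 by nra.
apply: (Rmult_le_reg_l Q) => //.
apply: Rle_trans (_ : (P1 * P2) * ((t1 + t2 + (/ rho + 1) * (t1 * t2)) * (1 - rho * (Y1 * Y2))) <= _).
  rewrite -Rmult_assoc -[X in _ <= X]Rmult_assoc; apply: Rmult_le_compat_r; lra.
apply: Rle_trans (Rmult_le_compat_l _ _ _ (Rlt_le _ _ p12) key) _.
have c0 : 0 <= rho * (Y1 * Y2 - 1) by nra.
apply: Rle_trans (_ : rho * (Y1 * Y2 - 1) * (Q * P) <= _); last lra.
have := Rmult_le_compat_l _ _ _ c0 lb; rewrite /Rdiv; lra.
Qed.

(** * Reductions preserve the invariant *)

Local Open Scope nat_scope.

(** Decides whether the edge singled out after a reduction is the new edge or one of the old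
    ones. *)
Lemma Permutation_cons_cases (T : Type) (a b : T) l m : Permutation (a :: l) (b :: m) ->
  (b = a /\ Permutation m l) \/
  exists2 k, Permutation l (b :: k) & Permutation m (a :: k).
Proof.
move=> p; have [s1 [s2 e]] := Permutation_vs_cons_inv p.
case: s1 e => [|c s1] /= [ac e]; subst.
  left; split=> //; apply: Permutation_sym; exact: Permutation_cons_inv p.
right; exists (s1 ++ s2).
  by apply: Permutation_sym; exact: Permutation_middle.
apply: (@Permutation_cons_inv _ _ _ b); apply: Permutation_trans (Permutation_sym p) _.
apply: Permutation_trans (perm_swap _ _ _).
by apply: perm_skip; apply: Permutation_sym; exact: Permutation_middle.
Qed.

Lemma Permutation_all (T : Type) (a : pred T) s s' : Permutation s s' -> all a s = all a s'.
Proof. by elim=> //= [x l l' _ ->|x y l|l1 l2 l3 _ -> _ ->] //; rewrite andbCA. Qed.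

Lemma Permutation_count (T : Type) (a : pred T) s s' : Permutation s s' -> count a s = count a s'.
Proof. by elim=> //= [x l l' _ ->|x y l|l1 l2 l3 _ -> _ ->] //; rewrite addnCA. Qed.

Lemma perm_eq_Permutation (T : eqType) (s s' : seq T) : perm_eq s s' -> Permutation s s'.
Proof.
elim: s s' => [|x s IH] s' p.
  by move: (perm_size p) => /esym /size0nil ->; exact: perm_nil.
have xs' : x \in s' by rewrite -(perm_mem p) mem_head.
case/splitPr: xs' p => s1 s2 p; apply: Permutation_trans (Permutation_middle _ _ _).
by apply: perm_skip; apply: IH; rewrite -(perm_cons x) (perm_trans p) // perm_catC /= perm_cons perm_catC.
Qed.

(** Writing the list as [e :: r] up to permutation singles out one occurrence of an edge together
    with all the others, so parallel copies stay distinct and [conn] on [r] says that [e] is not a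
    bridge. *)
Definition flow_invariant (q : cplx) (rho X : R) (L n : nat) (es : seq wedge) : Prop :=
  [/\ all (proper_edge n) es, flow_le n es L &
      forall e r, Permutation es (e :: r) -> trans_den q e <> Czero /\
        (conn [seq ends i | i <- r] (src e) (tgt e) -> good q rho X e)].

Section Invariant.

Variables (L : nat) (q : cplx) (rho X : R).
Hypothesis reg : regime L q rho X.

Lemma inv_perm n es es' : Permutation es es' ->
  flow_invariant q rho X L n es -> flow_invariant q rho X L n es'.
Proof.
move=> p [pr fl br]; split; first by rewrite -(Permutation_all _ p).
  by apply: flow_le_capacity fl => u v; rewrite (capacity_perm _ _ p).
by move=> e r p'; apply: br; exact: Permutation_trans p'.
Qed.

Lemma inv_nonbridge n e r : flow_invariant q rho X L n (e :: r) ->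
  conn [seq ends i | i <- r] (src e) (tgt e) -> cap e < L /\ good q rho X e.
Proof.
move=> [pr fl br] c; split; first exact: nonbridge_cap fl pr c.
by have [_] := br e r (Permutation_refl _); apply.
Qed.

(** Each of the two edges is bypassed by the other, hence neither is a bridge and both are good with
    capacity below [L]. The other edges keep their status as bridges or non-bridges. *)
Lemma inv_parallel n e1 e2 es : ends e1 = ends e2 ->
  flow_invariant q rho X L n (e1 :: e2 :: es) -> flow_invariant q rho X L n (parallel_edge e1 e2 :: es).
Proof.
move=> e12 I; case: (I) => pr fl br.
have sw : Permutation (e1 :: e2 :: es) (e2 :: e1 :: es) by exact: perm_swap.
case: (e12) => es12 et12.
have [c1 g1] : cap e1 < L /\ good q rho X e1.
  apply: (inv_nonbridge I); apply: conn_adj => /=.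
  by rewrite -e12 /ends joins_id.
have [c2 g2] : cap e2 < L /\ good q rho X e2.
  apply: (inv_nonbridge (inv_perm sw I)); apply: conn_adj => /=.
  by rewrite e12 /ends joins_id.
have [d1 _] := br _ _ (Permutation_refl _); have [d2 _] := br _ _ sw.
have fl' := flow_le_parallel e12 fl.
have pr' : all (proper_edge n) (parallel_edge e1 e2 :: es).
  move: pr => /= /and3P [/and4P [h1 h2 h3 h4] _ ->].
  by rewrite /proper_edge /= h1 h2 h3 andbT /=; lia.
split; [exact: pr'|exact: fl'|] => e r pe.
have [[-> p]|[k p1 p2]] := Permutation_cons_cases pe.
  split; first exact: trans_den_parallel_neq0 c1 c2 g1 g2 d1 d2.
  move=> c; apply: (good_parallel reg) => //.
  apply: (nonbridge_cap fl' pr'); apply: conn_perm c; exact: Permutation_map.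
have p3 : Permutation (e1 :: e2 :: es) (e :: e1 :: e2 :: k).
  apply: Permutation_trans (perm_skip _ (perm_skip _ p1)) _.
  apply: Permutation_trans (perm_skip _ (perm_swap _ _ _)) _; exact: perm_swap.
have [d g] := br _ _ p3; split=> // c; apply: g.
have {c} := conn_perm (Permutation_map ends p2) c; apply: conn_sub => u v /=.
by rewrite /ends /= => /orP [->|->]; rewrite ?orbT.
Qed.

(** If the new edge is not a bridge, a connection of [x] and [y] elsewhere bypasses each half by way
    of the other, so both halves are good. If it is a bridge, only the product of the denominators
    matters. *)
Lemma inv_series n e1 e2 es x y : all (proper_edge n) es -> x < n -> y < n -> x != y ->
  ends e1 = (x, n) -> ends e2 = (n, y) ->
  flow_invariant q rho X L n.+1 (e1 :: e2 :: es) ->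
  flow_invariant q rho X L n (series_edge q x y e1 e2 :: es).
Proof.
move=> pres hx hy xy h1 h2 I; case: (I) => pr fl br.
have sw : Permutation (e1 :: e2 :: es) (e2 :: e1 :: es) by exact: perm_swap.
have [d1 _] := br _ _ (Permutation_refl _); have [d2 _] := br _ _ sw.
have [cap1 cap2] : 0 < cap e1 /\ 0 < cap e2.
  by move: pr => /= /and3P [/and4P [_ _ _ ?] /and4P [_ _ _ ?] _].
have fl' : flow_le n (series_edge q x y e1 e2 :: es) L by exact: (flow_le_series _ _ _ _ _ fl).
have a1 : joins (ends e1) x n by rewrite h1 joins_id.
have a2 : joins (ends e2) n y by rewrite h2 joins_id.
split; [by rewrite /= pres /proper_edge /= hx hy xy|exact: fl'|].
move=> e r pe.
have [[-> p]|[k p1 p2]] := Permutation_cons_cases pe.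
  rewrite trans_den_series; split; first exact: Cmul_neq0.
  move=> /(conn_perm (Permutation_map ends p)) /= c.
  have [c1 g1] : cap e1 < L /\ good q rho X e1.
    apply: (inv_nonbridge I); case: (h1) => -> ->; apply: conn_trans (conn_cons _ c) _.
    by apply: conn_adj; rewrite /= joinsC a2.
  have [c2 g2] : cap e2 < L /\ good q rho X e2.
    apply: (inv_nonbridge (inv_perm sw I)); case: (h2) => -> ->.
    apply: (@conn_trans _ x); last exact: conn_cons.
    by apply: conn_adj; rewrite /= joinsC a1.
  exact: good_series c1 c2 g1 g2.
have p3 : Permutation (e1 :: e2 :: es) (e :: e1 :: e2 :: k).
  apply: Permutation_trans (perm_skip _ (perm_skip _ p1)) _.
  apply: Permutation_trans (perm_skip _ (perm_swap _ _ _)) _; exact: perm_swap.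
have [d g] := br _ _ p3; split=> // c; apply: g.
have {c} := conn_perm (Permutation_map ends p2) c; apply: (@conn_lift id) => u v /= /orP [|h].
  have cxy : conn [:: ends e1, ends e2 & [seq ends i | i <- k]] x y.
    by apply: (@conn_trans _ n); apply: conn_adj; rewrite /= ?a1 ?a2 ?orbT.
  case/joinsP => /= -[<- <-] //; exact: conn_sym.
by do 2 apply: conn_cons; exact: conn_adj.
Qed.

End Invariant.

(** * Invariance under isomorphism *)

Section Relabel.

Variables (n : nat) (f : nat -> nat).
Hypothesis fn : forall x, x < n -> f x < n.
Hypothesis finj : {in [pred x | x < n] &, injective f}.

(** Orientation may flip, since an isomorphism keeps the ends of an edge only as an unordered
    pair. *)
Definition rel_ends (s' s : nat * nat) : Prop := joins s (f s'.1) (f s'.2).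
Definition rel_wedge (e' e : wedge) : Prop :=
  [/\ rel_ends (ends e') (ends e), cap e = cap e', wout e = wout e' & win e = win e'].

Lemma rel_ends_joins s' s u v : rel_ends s' s -> joins s' u v -> joins s (f u) (f v).
Proof. by move=> h /joinsP [[<- <-]|[<- <-]] //; rewrite joinsC. Qed.

Lemma rel_adj S' S u v : List.Forall2 rel_ends S' S -> adj S' u v -> adj S (f u) (f v).
Proof.
elim=> //= s' s l' l h _ IH /orP [/(rel_ends_joins h) ->|/IH ->] //; by rewrite orbT.
Qed.

Lemma rel_adj_inv S' S u z : List.Forall2 rel_ends S' S -> ends_below n S' -> u < n ->
  adj S (f u) z -> exists2 w, w < n /\ z = f w & adj S' u w.
Proof.
move=> h + hu; elim: h => //= -[a b] s l' l + _ IH /andP [/andP [/= ha hb] bl].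
move=> h /orP [|al]; last first.
  by have [w hw aw] := IH bl al; exists w; rewrite // aw orbT.
move: h; rewrite /rel_ends /= => h; move/joinsP: (h) => h'; move/joinsP.
case=> -[e1 e2]; rewrite e1 e2 in h'; case: h' => -[j1 j2].
- by rewrite (finj hu ha j1); exists b; rewrite // joins_id.
- by rewrite (finj hu hb j1); exists a; rewrite // joinsC joins_id.
- by rewrite (finj hu hb j2); exists a; rewrite // joinsC joins_id.
- by rewrite (finj hu ha j2); exists b; rewrite // joins_id.
Qed.

Lemma rel_conn S' S x y : List.Forall2 rel_ends S' S -> ends_below n S' -> x < n -> y < n ->
  (conn S' x y <-> conn S (f x) (f y)).
Proof.
move=> h bS hx hy; split.
  by apply: conn_lift => u v /(rel_adj h) /conn_adj.
move=> [p]; elim: p x hx => [|z p IH] x hx /=.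
  by move=> _ /finj ->; rewrite ?inE //; exact: conn_refl.
case/andP=> /(rel_adj_inv h bS hx) [w [hw ->] xw] pp lp.
by apply: conn_trans (IH _ hw pp lp); exact: conn_adj.
Qed.

Lemma rel_Zlist q es' es S' S : List.Forall2 rel_wedge es' es -> List.Forall2 rel_ends S' S ->
  ends_below n [seq ends e | e <- es'] -> ends_below n S' ->
  Zlist q n es' S' = Zlist q n es S.
Proof.
move=> h; elim: h S' S => [|e' e l' l [he hc ho hi] _ IH] S' S hS /= b bS.
  congr Cpow; apply: (comps_relabel fn finj) => x y; exact: rel_conn.
case/andP: b => be bl; rewrite ho hi (IH S' S) // (IH (ends e' :: S') (ends e :: S)) //=.
  exact: List.Forall2_cons.
by rewrite be.
Qed.

Lemma rel_capacity es' es u v : List.Forall2 rel_wedge es' es ->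
  capacity es' u v <= capacity es (f u) (f v).
Proof.
rewrite /capacity; elim=> //= e' e l' l [he -> _ _] _ IH; apply: leq_add => //.
by rewrite leq_mul2r; case: (boolP (joins (ends e') u v)) => [/(rel_ends_joins he) ->|_]; rewrite orbT.
Qed.

Lemma joins_relabel d u v : d.1 < n -> d.2 < n -> u < n -> v < n ->
  joins (f d.1, f d.2) (f u) (f v) = joins d u v.
Proof.
move=> h1 h2 hu hv; apply/joinsP/joinsP => /= -[[]|[]].
- by move=> /finj -> // /finj -> //; left.
- by move=> /finj -> // /finj -> //; right.
- by move=> -> ->; left.
by move=> -> ->; right.
Qed.

Lemma steps_map x p : steps (f x) [seq f z | z <- p] =
  [seq (f d.1, f d.2) | d <- steps x p].
Proof. by elim: p x => //= y p IH x; rewrite IH. Qed.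

Lemma steps_below m x p : all (fun z => z < m) (x :: p) -> ends_below m (steps x p).
Proof. by elim: p x => //= y p IH x /and3P [-> hy hp]; rewrite hy IH //= hy. Qed.

Lemma rel_flow_le es' es L : List.Forall2 rel_wedge es' es -> flow_le n es L -> flow_le n es' L.
Proof.
move=> h fl x y P hx hy xy vP us.
pose D := flatten [seq steps x p | p <- P].
have bD d : d \in D -> d.1 < n /\ d.2 < n.
  case/flattenP=> _ /mapP [p /(allP vP) /and3P [ap _ _] ->].
  by move/(allP (steps_below ap))/andP.
rewrite -(size_map (map f)); apply: (fl (f x) (f y)).
- exact: fn.
- exact: fn.
- by apply: contra xy => /eqP /finj ->.
- rewrite all_map; apply: sub_all vP => p /and3P [ap /eqP lp up]; apply/and3P; split.
  + rewrite -map_cons all_map; apply: sub_all ap => z; exact: fn.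
  + by rewrite last_map lp.
  rewrite -map_cons map_inj_in_uniq // => a b /(allP ap) ha /(allP ap) hb; exact: finj.
move=> u v; rewrite /usage -map_comp.
have -> : flatten [seq (steps (f x) \o map f) p | p <- P] = [seq (f d.1, f d.2) | d <- D].
  rewrite /D map_flatten -map_comp; congr flatten; apply: eq_map => p /=; exact: steps_map.
(* A pair met by no step is trivial; any other is the image of a step [d] of the original family,
   and the bound is carried over from the ends of [d]. *)
case: (posnP (count (fun e => joins e u v) [seq (f d.1, f d.2) | d <- D])) => [-> //|].
rewrite -has_count => /hasP [_ /mapP [d dD ->] j].
have [hd1 hd2] := bD d dD.
have jE e : joins e u v = joins e (f d.1) (f d.2) by apply: joins_trans; rewrite joinsE in j; rewrite joinsE.
apply: leq_trans (_ : capacity es' d.1 d.2 <= _); last first.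
  apply: leq_trans (rel_capacity _ _ h) _; rewrite /capacity leq_eqVlt; apply/orP; left; apply/eqP.
  by congr sumn; apply: eq_map => e; rewrite jE.
apply: leq_trans (us d.1 d.2); rewrite count_map /usage -/D.
rewrite (@eq_in_count _ _ (fun e => joins e d.1 d.2)) // => e /bD [he1 he2].
by rewrite /= jE joins_relabel.
Qed.

Lemma rel_inv q rho X L es' es : List.Forall2 rel_wedge es' es ->
  all (proper_edge n) es' -> flow_invariant q rho X L n es -> flow_invariant q rho X L n es'.
Proof.
move=> h pr' [pr fl br]; split=> //; first exact: rel_flow_le fl.
move=> e' r' p; have [l [p' h']] := Permutation_Forall2 p h.
inversion h' as [|? e ? r [he hc ho hi] hr]; subst.
have [d g] := br _ _ p'; split; first by rewrite /trans_den -ho -hi.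
move=> c; rewrite /good /trans_den -hc -ho -hi; apply: g.
have c' : conn [seq ends i | i <- r] (f (src e')) (f (tgt e')).
  apply: conn_lift c => u v a; apply: conn_adj; apply: rel_adj a.
  by elim: hr => [|a b l' l [? _ _ _] _ IH] /=; constructor.
by case/joinsP: he => /= -[-> ->] //; exact: conn_sym.
Qed.

End Relabel.

(** * Nonvanishing for series-parallel graphs *)

Definition realizes (G : mgraph) (t : seq nat) (D : seq (nat * nat)) : bool :=
  all2 (fun i d => joins (endp G i) d.1 d.2) t D.

Lemma edges_endp G : [seq endp G i | i <- iota 0 (ne G)] = edges G.
Proof. exact: mkseq_nth. Qed.

(** A greedy choice succeeds: picking an edge for the first step lowers both counts by one at the
    same unordered pair. *)
Lemma distinct_edges G (A : seq nat) (D : seq (nat * nat)) : uniq A ->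
  (forall u v, count (fun e => joins e u v) D <= count (fun i => joins (endp G i) u v) A) ->
  exists2 t, uniq t /\ {subset t <= A} & realizes G t D.
Proof.
elim: D A => [|[x y] D IH] A uA h; first by exists [::].
have := h x y; rewrite /= joins_id add1n => hc.
have /hasP [i iA ji] : has (fun i => joins (endp G i) x y) A.
  by rewrite has_count; exact: leq_trans hc.
have jE u v : joins (endp G i) u v = joins (x, y) u v.
  by case/joinsP: ji; case: (endp G i) => a b /= [-> ->] //; exact: joins_swap.
have [||t [ut tA] rt] := IH (rem i A); first exact: rem_uniq.
  move=> u v; have := h u v; rewrite (permP (perm_to_rem iA)) /= jE.
  by rewrite leq_add2l.
exists (i :: t); last by rewrite /realizes /= ji.
split=> [|j]; last by rewrite inE => /orP [/eqP -> //|/tA /mem_rem].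
by rewrite /= ut andbT; apply/negP => /tA; rewrite mem_rem_uniqF.
Qed.

Lemma distinct_edges_count G D :
  (forall u v, count (fun e => joins e u v) D <= count (fun e => joins e u v) (edges G)) ->
  exists2 t, uniq t /\ all (fun i => i < ne G) t & realizes G t D.
Proof.
move=> h; have [|t [ut tA] rt] := @distinct_edges G (iota 0 (ne G)) D (iota_uniq _ _).
  by move=> u v; apply: leq_trans (h u v) _; rewrite -{1}edges_endp count_map.
by exists t => //; split=> //; apply/allP => i /tA; rewrite mem_iota.
Qed.

Lemma realizes_cat G t t' D D' : size t = size D ->
  realizes G (t ++ t') (D ++ D') = realizes G t D && realizes G t' D'.
Proof.
by rewrite /realizes; elim: t D => [|i t IH] [|d D] //= [/IH ->]; rewrite andbA.
Qed.

Lemma realizes_steps G x p t : realizes G t (steps x p) -> all (fun i => i < ne G) t ->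
  walk G x (last x p) t /\ trail G x t = x :: p.
Proof.
rewrite /realizes; elim: p x t => [|y p IH] x [|i t] //=.
case/andP=> /= ji rt /andP [-> at_].
have -> : other G i x = y.
  by rewrite /other; case/joinsP: ji => -[-> ->]; rewrite ?eqxx //; case: eqP.
have -> : incident G i x by rewrite /incident; case/joinsP: ji => -[-> ->]; rewrite eqxx ?orbT.
by have [-> ->] := IH y t rt at_.
Qed.

Lemma realizes_family G x (P : seq (seq nat)) t :
  realizes G t (flatten [seq steps x p | p <- P]) -> all (fun i => i < ne G) t ->
  exists2 T, flatten T = t & size T = size P /\
    all2 (fun s p => realizes G s (steps x p) && all (fun i => i < ne G) s) T P.
Proof.
elim: P t => [|p P IH] t; first by case: t => // _ _; exists [::].
rewrite /= -{1 2}(cat_take_drop (size (steps x p)) t) => r.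
have hs : size (take (size (steps x p)) t) = size (steps x p).
  have := r; rewrite /realizes all2E => /andP [/eqP]; rewrite !size_cat => hs _.
  by move: hs; rewrite size_take size_drop; case: ltnP; lia.
rewrite realizes_cat // in r; case/andP: r => r1 r2.
rewrite all_cat => /andP [a1 a2].
have [T eT [sT aT]] := IH _ r2 a2.
exists (take (size (steps x p)) t :: T); first by rewrite /= eT cat_take_drop.
by rewrite /= sT aT; rewrite r1 a1.
Qed.

(** With unit capacities, distinct edges can be assigned to all steps of a vertex-path family, which
    makes it a family of edge-disjoint paths of [G]. *)
Lemma maxmaxflow_flow_le G es L : [seq ends e | e <- es] = edges G ->
  all (fun e => cap e == 1) es -> maxmaxflow_le G L -> flow_le (nv G) es L.
Proof.
move=> ee c1 mm x y P hx hy xy vP us.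
have capE u v : capacity es u v = count (fun e => joins e u v) (edges G).
  rewrite -ee /capacity; elim: es c1 {ee us} => //= e es IH /andP [/eqP -> /IH ->].
  by rewrite muln1.
have [|t [ut at_] rt] := @distinct_edges_count G (flatten [seq steps x p | p <- P]).
  by move=> u v; rewrite -capE; exact: us.
have [T eT [sT aT]] := realizes_family rt at_.
rewrite -sT; apply: (mm x y) => //; rewrite /edge_disjoint_paths eT ut andbT.
elim: T P vP aT {us rt eT sT} => [//|s T IH] [|p P] //= /andP [/and3P [_ /eqP lp up] vP].
case/andP=> /andP [rs as_] aT; rewrite (IH P) // andbT /is_path.
by have [w ->] := realizes_steps rs as_; rewrite -lp w.
Qed.

(** A connection avoiding the edge closes up with it to a cycle; [distinct_edges_count] supplies
    different edge indices even when the cycle has length two. *)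
Lemma forest_bridge G r x y : forest G -> Permutation (edges G) ((x, y) :: r) -> ~ conn r x y.
Proof.
move=> [wf _ acyc] p c; apply: acyc.
have /andP [bxy br] : ends_below (nv G) ((x, y) :: r) by rewrite /ends_below -(Permutation_all _ p).
case/andP: bxy => /= hx hy.
have [s ps /and3P [_ /eqP ls us]] := conn_path br hy (conn_sym c).
have [|t [ut at_] rt] := @distinct_edges_count G (steps x (y :: s)).
  move=> u v; rewrite (Permutation_count _ p) /= leq_add2l.
  apply: leq_trans (count_steps_adj _ _ us ps) _.
  by case: (boolP (adj r u v)) => // h; rewrite -has_count.
have [w tr] := realizes_steps rt at_.
exists x, t; split=> //; rewrite /is_cycle ut tr; apply/and4P; split=> //.
  by case: t rt {ut at_ w tr}.
by move: w; rewrite /= ls.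
Qed.

Lemma iota_reindex m (g : nat -> nat) : (forall i, i < m -> g i < m) ->
  {in [pred i | i < m] &, injective g} -> perm_eq [seq g i | i <- iota 0 m] (iota 0 m).
Proof.
move=> gm ginj; have ug : uniq [seq g i | i <- iota 0 m].
  by rewrite map_inj_in_uniq ?iota_uniq // => i j; rewrite !mem_iota; exact: ginj.
apply: uniq_perm => //; first exact: iota_uniq.
have [||_ //] := uniq_min_size ug (s2 := iota 0 m); last by rewrite size_map.
by move=> _ /mapP [i hi ->]; move: hi; rewrite !mem_iota; exact: gm.
Qed.

Lemma series_parallel_wf G : series_parallel G -> wf_graph G /\ loopless G.
Proof.
elim=> {G} [G [] //|G i _ [wf lo] hi|G i _ [wf lo] hi|G H _ [wf lo] [env [ene [f [g [fn finj gn ginj h]]]]]].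
- have hin : endp G i \in edges G by exact: mem_nth.
  have /andP [h1 h2] := allP wf _ hin.
  have split_edges : edges G = take i (edges G) ++ endp G i :: drop i.+1 (edges G).
    by rewrite -drop_nth // cat_take_drop.
  move: wf lo; rewrite /wf_graph /loopless {1 2}split_edges /subdivide /=.
  rewrite set_nthE hi !all_cat /= => /and3P [w1 _ w2] /and3P [l1 _ l2].
rewrite l1 l2 (ltn_eqF h1) [nv G == _]eq_sym (ltn_eqF h2) ltnSn !(ltnW h1, ltnW h2, ltnS) /= !andbT.
  split=> //; apply/andP; split; [apply: sub_all w1|apply: sub_all w2] => e.
    by move=> /= /andP [/ltnW h3 /ltnW h4]; rewrite !ltnS h3 h4.
  by move=> /= /andP [/ltnW h3 /ltnW h4]; rewrite !ltnS h3 h4.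
- have hin : endp G i \in edges G by exact: mem_nth.
  have /andP [h1 h2] := allP wf _ hin; have h3 := allP lo _ hin.
  by move: wf lo; rewrite /wf_graph /loopless /= !all_cat => -> -> /=; rewrite h1 h2 h3.
(* The injection [g] between equally many edges is onto, so every edge of [H] comes from one of
   [G]. *)
have surj e : e \in edges H -> exists2 d, d \in edges G &
    e = (f d.1, f d.2) \/ e = (f d.2, f d.1).
  move/(nthP (0, 0)) => [j hj <-]; rewrite -[size _]/(ne H) -ene in hj.
  have : j \in [seq g i | i <- iota 0 (ne G)].
    by rewrite (perm_mem (iota_reindex _ ginj)) ?mem_iota // => i /gn; rewrite ene.
  case/mapP=> i; rewrite mem_iota => hi ej; exists (endp G i); first exact: mem_nth.
  by rewrite ej; exact: h.
split; apply/allP => e /surj [d dG [->|->]] /=; have /andP [d1 d2] := allP wf _ dG;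
  rewrite ?fn //; have /= := allP lo _ dG; apply: contra => /eqP /finj; rewrite !inE => ed;
  by rewrite ed.
Qed.

(** * Induction over the series-parallel construction *)

Section Nonvanishing.

Variables (L : nat) (q : cplx) (rho X : R).
Hypothesis reg : regime L q rho X.

Lemma all_proper_caps n S es : wf_graph (MGraph n S) -> loopless (MGraph n S) ->
  [seq ends e | e <- es] = S -> all (fun e => 0 < cap e) es -> all (proper_edge n) es.
Proof.
move=> wf lo ee; move: wf lo; rewrite /wf_graph /loopless /= -ee !all_map.
elim: es {ee} => //= e es IH /andP [/andP [h1 h2] wf] /andP [h3 lo] /andP [h4 hc].
by rewrite IH // /proper_edge h1 h2 h3 h4.
Qed.

Lemma proper_caps n es : all (proper_edge n) es -> all (fun e => 0 < cap e) es.
Proof. by apply: sub_all => e /and4P []. Qed.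

Lemma map_ends_split es s1 e s2 : [seq ends i | i <- es] = s1 ++ e :: s2 ->
  exists t1 w t2, [/\ es = t1 ++ w :: t2, [seq ends i | i <- t1] = s1, ends w = e &
    [seq ends i | i <- t2] = s2].
Proof.
elim: s1 es => [|a s1 IH] [|w es] //= [h1 h2]; first by exists [::], w, es.
have [t1 [w' [t2 [-> e1 e2 e3]]]] := IH _ h2.
by exists (w :: t1), w', t2; rewrite /= e1 h1.
Qed.

(** All edges are bridges, so [Zlist_forest] equates a power of [q] times [Z] with a product of
    nonzero factors. *)
Lemma forest_nonzero G es : forest G -> [seq ends e | e <- es] = edges G ->
  flow_invariant q rho X L (nv G) es -> Zlist q (nv G) es [::] <> Czero.
Proof.
move=> fG ee [pr fl br] z0.
have q0 := regime_q_neq0 reg.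
have qn n : Cpow q n <> Czero.
  by elim: n => [|n IH] /=; [move=> [] /R1_neq_R0 | exact: Cmul_neq0].
have := @Zlist_forest q (nv G) es [::] (proper_below pr); rewrite z0 cats0.
have -> : Cmul (Cpow q (size es)) Czero = Czero by ring.
have bridge e r : Permutation [seq ends e | e <- es] (e :: r) -> ~ conn r e.1 e.2.
  by rewrite ee; case: e => x y; exact: forest_bridge.
move/(_ bridge)/esym; apply: Cmul_neq0 => //; apply: foldr_Cmul_neq0; apply/List.Forall_forall => e.
move/(@List.in_split _ _ _) => [l1 [l2 el]].
have [] // := br e (l1 ++ l2); rewrite el; apply: Permutation_sym; exact: Permutation_middle.
Qed.

(** The induction ranges over all weighted edge lists with the ends of [G]: undoing the last series
    or parallel operation merges two weighted edges into one with the same [Z] and keeps the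
    invariant. *)
Lemma series_parallel_nonzero G es : series_parallel G -> [seq ends e | e <- es] = edges G ->
  flow_invariant q rho X L (nv G) es -> Zlist q (nv G) es [::] <> Czero.
Proof.
move=> sp; elim: sp es => {G} [G fG|G i sp IH hi|G i sp IH hi|G H sp IH iso] es ee I.
- exact: forest_nonzero fG ee I.
- have [wf lo] := series_parallel_wf sp.
  have hin : endp G i \in edges G by exact: mem_nth.
  have /andP [hx hy] := allP wf _ hin; have xy := allP lo _ hin.
  move: ee; rewrite /subdivide /= set_nthE hi -catA /= => ee.
  have [t1 [e1 [t2 [et m1 m2 m3]]]] := map_ends_split ee.
  have [t3 [e2 [t4 [et' m4 m5 m6]]]] := map_ends_split m3.
  have t40 : t4 = [::] by case: t4 m6 {et'}.
  subst es t2 t4; set x := (endp G i).1 in hx xy m2; set y := (endp G i).2 in hy xy m5.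
  (* One half of the subdivided edge sits at position [i], the other at the end of the list; both
     are brought to the front. *)
  have p : Permutation (t1 ++ e1 :: t3 ++ [:: e2]) (e1 :: e2 :: t1 ++ t3).
    have p0 : Permutation (t1 ++ t3 ++ [:: e2]) (e2 :: t1 ++ t3).
      by rewrite catA; apply: Permutation_sym; exact: Permutation_cons_append.
    apply: Permutation_trans (Permutation_sym (Permutation_middle _ _ _)) _.
    by apply: perm_skip; exact: p0.
  pose e := series_edge q x y e1 e2.
  have ee' : [seq ends i | i <- t1 ++ e :: t3] = edges G.
    rewrite map_cat /= m1 m4 [ends e]/ends /= /x /y -surjective_pairing -drop_nth //.
    exact: cat_take_drop.
  have p' : Permutation (t1 ++ e :: t3) (e :: t1 ++ t3).
    by apply: Permutation_sym; exact: Permutation_middle.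
  have prt : all (proper_edge (nv G)) (t1 ++ e :: t3).
    apply: (@all_proper_caps _ (edges G)) => //.
    by case: I => /proper_caps; rewrite !all_cat /= !all_cat => /and3P [-> _ /andP [-> _]].
  have prt' : all (proper_edge (nv G)) (t1 ++ t3).
    by move: prt; rewrite !all_cat /= => /and3P [-> _ ->].
  rewrite (Zlist_perm _ _ _ p) (Zlist_series _ (proper_below prt') hx hy m2 m5).
  rewrite -(Zlist_perm _ _ _ p'); apply: IH => //.
  apply: inv_perm (Permutation_sym p') _; apply: inv_series => //.
  exact: inv_perm p I.
- move: ee; rewrite /parallel /= => ee.
  have [t1 [e2 [t2 [et m1 m2 m3]]]] := map_ends_split ee.
  have t20 : t2 = [::] by case: t2 m3 {et}.
  subst es t2.
  have := m1; rewrite -{1}(cat_take_drop i (edges G)) (drop_nth (0, 0)) // => m1'.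
  have [t3 [e1 [t4 [et m4 m5 m6]]]] := map_ends_split m1'; subst t1.
  have p : Permutation ((t3 ++ e1 :: t4) ++ [:: e2]) (e1 :: e2 :: t3 ++ t4).
    apply: Permutation_trans (Permutation_sym (Permutation_cons_append _ _)) _.
    apply: Permutation_trans (perm_swap _ _ _); apply: perm_skip.
    by apply: Permutation_sym; exact: Permutation_middle.
  have e12 : ends e1 = ends e2 by rewrite m2 m5.
  have p' : Permutation (t3 ++ parallel_edge e1 e2 :: t4) (parallel_edge e1 e2 :: t3 ++ t4).
    by apply: Permutation_sym; exact: Permutation_middle.
  rewrite (Zlist_perm _ _ _ p) Zlist_parallel // -(Zlist_perm _ _ _ p').
  apply: IH; first by rewrite -m1 !map_cat.
  apply: inv_perm (Permutation_sym p') _; apply: inv_parallel => //.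
  exact: inv_perm p I.
have [wf lo] := series_parallel_wf sp.
case: iso => env [ene [f [g [fn finj gn ginj h]]]].
rewrite -env in fn I *; rewrite -ene in gn.
have sz : size es = ne G by rewrite ene /ne -ee size_map.
(* A default for [nth], never reached because [g j] is below [size es]. The list [w'] puts the
   weights found on [H] onto the edges of [G]. *)
pose e0 := Wedge 0 0 0 Cone Cone.
pose w j := nth e0 es (g j).
pose w' j := Wedge (endp G j).1 (endp G j).2 (cap (w j)) (wout (w j)) (win (w j)).
have p : Permutation es [seq w j | j <- iota 0 (ne G)].
  rewrite -{1}(mkseq_nth e0 es) /mkseq sz /w.
  rewrite (map_comp (nth e0 es) g); apply: Permutation_map.
  apply: perm_eq_Permutation; rewrite perm_sym; exact: iota_reindex.
have ee' : [seq ends e | e <- [seq w' j | j <- iota 0 (ne G)]] = edges G.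
  by rewrite -map_comp -[RHS]edges_endp; apply: eq_map => j; rewrite /ends /= -surjective_pairing.
have rw : List.Forall2 (rel_wedge f) [seq w' j | j <- iota 0 (ne G)] [seq w j | j <- iota 0 (ne G)].
  have : all (fun j => j < ne G) (iota 0 (ne G)) by apply/allP => j; rewrite mem_iota.
  elim: (iota _ _) => [|j s IHs] /=; first by constructor.
  case/andP=> hj /IHs ?; constructor=> //; split=> //; rewrite /rel_ends /=.
  have -> : ends (w j) = endp H (g j) by rewrite /w -(nth_map e0 (0, 0) ends) ?ee // sz; exact: gn.
  by case: (h j hj) => ->; rewrite ?joins_id // joinsC joins_id.
have I2 := inv_perm p I.
have pr' : all (proper_edge (nv G)) [seq w' j | j <- iota 0 (ne G)].
  apply: (@all_proper_caps _ (edges G)) => //.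
  by case: I2 => /proper_caps; rewrite !all_map.
rewrite (Zlist_perm _ _ _ p) -(rel_Zlist fn finj q rw (List.Forall2_nil _) (proper_below pr')) //.
by apply: IH => //; exact: (rel_inv fn finj rw) pr' I2.
Qed.

Lemma ZG_nonzero G v : series_parallel G -> maxmaxflow_le G L ->
  (forall e, trans_den q (@unit_wedge G v e) <> Czero /\ good q rho X (unit_wedge v e)) ->
  ZG G q v <> Czero.
Proof.
move=> sp mm hv; have [wf lo] := series_parallel_wf sp.
have ee := map_ends_unit_wedge v.
rewrite ZG_Zlist //; apply: series_parallel_nonzero => //; split.
- apply: (@all_proper_caps _ (edges G)) => //.
  by rewrite all_map; apply/allP.
- by apply: maxmaxflow_flow_le => //; rewrite all_map; apply/allP.
move=> e r /Permutation_sym p.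
have /List.in_map_iff [i [<- _]] : List.In e [seq unit_wedge v i | i <- enum 'I_(ne G)].
  by apply: Permutation_in p _; left.
by case: (hv i).
Qed.

End Nonvanishing.

Local Open Scope R_scope.

(** * From the hypotheses on [q] and the weights to the regime *)

Lemma pow_lt_mono a b n : 0 <= a < b -> (0 < n)%N -> a ^ n < b ^ n.
Proof.
move=> ab; case: n => // n _; elim: n => [|n IH]; first by rewrite !pow_1; lra.
by apply: Rmult_le_0_lt_compat IH => //; [lra | apply: pow_le; lra | lra].
Qed.

(** This [X] satisfies [X^(L-1) * (1 + rho) = 2]. If the last condition failed, its power [L - 1]
    times [1 + rho] would contradict admissibility. *)
Lemma regime_intro L q rho : (2 <= L)%N -> 0 < rho < 1 -> rho * Cnorm (Csub q Cone) = 1 ->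
  admissible L rho -> regime L q rho (Rpower (2 / (1 + rho)) (1 / INR (L - 1)%N)).
Proof.
move=> hL hr hq adm; have L1 : (0 < L - 1)%N by lia.
have nL : 0 < INR (L - 1)%N by apply: lt_0_INR; apply/ltP.
set X := Rpower _ _.
have X0 : 0 < X by exact: exp_pos.
have y0 : 0 < 2 / (1 + rho) by apply: Rmult_lt_0_compat; [lra | apply: Rinv_0_lt_compat; lra].
have XL : X ^ (L - 1) * (1 + rho) = 2.
  rewrite -Rpower_pow // /X Rpower_mult.
  have -> : 1 / INR (L - 1)%N * INR (L - 1)%N = 1 by field; lra.
  by rewrite Rpower_1 //; field; lra.
split=> //; try lra.
  apply: Rnot_lt_le => X1.
  have := @pow_lt_mono X 1 (L - 1) ltac:(lra) L1; rewrite pow1; nra.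
apply: Rnot_lt_le => bad.
have h := @pow_lt_mono (X * (1 + rho ^ 2)) (1 + rho) (L - 1) ltac:(nra) L1.
rewrite Rpow_mult_distr in h; move: adm; rewrite /admissible.
have -> : (1 + rho) ^ L = (1 + rho) * (1 + rho) ^ (L - 1).
  by rewrite tech_pow_Rmult; congr pow; lia.
have := Rmult_lt_compat_l (1 + rho) _ _ ltac:(lra) h.
have -> : (1 + rho) * (X ^ (L - 1) * (1 + rho ^ 2) ^ (L - 1)) =
  (X ^ (L - 1) * (1 + rho)) * (1 + rho ^ 2) ^ (L - 1) by ring.
rewrite XL; lra.
Qed.

Lemma Csub1_neq0 L q rho X : regime L q rho X -> Csub q Cone <> Czero.
Proof. by case=> _ h _ _ _ e; move: h; rewrite e Cnorm0; lra. Qed.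

Lemma unit_wedge_m1 L q rho X (G : mgraph) (v : 'I_(ne G) -> cplx) e :
  regime L q rho X -> v e = Copp Cone ->
  trans_den q (unit_wedge v e) <> Czero /\ good q rho X (unit_wedge v e).
Proof.
move=> reg ve; split; last by left; rewrite /= ve; ring.
have -> : trans_den q (unit_wedge v e) = Csub q Cone by rewrite /trans_den /= ve; ring.
exact: Csub1_neq0 reg.
Qed.

Lemma unit_wedge_good L q rho X (G : mgraph) (v : 'I_(ne G) -> cplx) e : (2 <= L)%N ->
  regime L q rho X -> Cadd q (v e) <> Czero ->
  Cnorm (Cdiv (v e) (Cadd q (v e))) <= rho * ((X - 1) / (1 - rho * X)) ->
  trans_den q (unit_wedge v e) <> Czero /\ good q rho X (unit_wedge v e).
Proof.
move=> hL reg qv hv.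
have dE : trans_den q (unit_wedge v e) = Cadd q (v e) by rewrite /trans_den /=; ring.
split; first by rewrite dE.
right; rewrite dE /= Rmult_1_r -{1}(Cdiv_mulK (v e) qv) CnormM.
have [_ _] := @regime_pow _ _ _ _ 1 reg hL; rewrite pow_1 => d0.
have := Cnorm_ge0 (Cadd q (v e)) => h0.
have : Cnorm (Cdiv (v e) (Cadd q (v e))) * (1 - rho * X) <= rho * (X - 1).
  apply: Rle_trans (Rmult_le_compat_r _ _ _ (Rlt_le _ _ d0) hv) _.
  apply: Req_le; field; lra.
nra.
Qed.

Lemma le_or_lt_R_le s a b : le_or_lt_R s a b -> a <= b.
Proof. by case: s => /=; lra. Qed.

Theorem theorem5p1 (L : nat) (hL : (2 <= L)%N) :
  (forall rs : R, is_rho_star L rs ->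
     (* zero-freeness of Z_G *)
     (forall (G : mgraph) (q : cplx) (v : 'I_(ne G) -> cplx),
        series_parallel G ->
        maxmaxflow_le G L ->
        le_or_lt_R (L == 2)%N (1 / rs) (Cnorm (Csub q Cone)) ->
        (let rho := 1 / Cnorm (Csub q Cone) in
         let X := Rpower (2 / (1 + rho)) (1 / INR (L - 1)%N) in
         forall e : 'I_(ne G),
           v e = Copp Cone \/
           (Cadd q (v e) <> Czero /\
            le_or_lt_R (L == 2)%N (Cnorm (Cdiv (v e) (Cadd q (v e))))
                                 (rho * ((X - 1) / (1 - rho * X))))) ->
        ZG G q v <> Czero)
     /\
     (* lower bound on rho*_L *)
     ln 2 / (INR L - 3 / 2 * ln 2) < rs)
  /\
  (* chromatic roots lie in the disc |q - 1| < (L - 3/2 log 2) / log 2 *)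
  (forall (G : mgraph) (q : cplx),
     series_parallel G ->
     maxmaxflow_le G L ->
     chromP G q = Czero ->
     Cnorm (Csub q Cone) < (INR L - 3 / 2 * ln 2) / ln 2).
Proof.
split=> [rs hrs|G q sp mm]; last first.
  move=> P0; apply: Rnot_le_lt => hq.
  have [l1 l2] := ln2_bounds.
  have hL2 := INR_ge hL; rewrite /= in hL2.
  have c0 : 0 < (INR L - 3 / 2 * ln 2) / ln 2.
    by apply: Rmult_lt_0_compat; [lra | apply: Rinv_0_lt_compat; lra].
  (* Here [rho = 1 / |q - 1|] is shown admissible directly from the radius of the disc, and every
     weight is [-1]. *)
  have q0 : 0 < / Cnorm (Csub q Cone) by apply: Rinv_0_lt_compat; lra.
  have [|r1 adm] := disc_admissible_lt hL q0.
    have -> : ln 2 / (INR L - 3 / 2 * ln 2) = / ((INR L - 3 / 2 * ln 2) / ln 2) by field; lra.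
    exact: Rinv_le_contravar.
  have Q0 : Cnorm (Csub q Cone) <> 0 by lra.
  have reg := @regime_intro L q _ hL (conj q0 r1) (Rinv_l _ Q0) (Rlt_le _ _ adm).
  by apply: (ZG_nonzero reg sp mm _ P0) => e; exact: unit_wedge_m1 reg _.
split=> [G q v sp mm hq hv|]; last exact: rho_star_gt.
have rs0 : 0 < rs by case: hrs => [[_ ->]|[_ [h _]]]; lra.
have irs : 0 < / rs by exact: Rinv_0_lt_compat.
have hq' := le_or_lt_R_le hq.
cbv zeta in hv; set rho := 1 / Cnorm _ in hv; set X := Rpower _ _ in hv.
have Q0 : 0 < Cnorm (Csub q Cone) by lra.
have rhoq : rho * Cnorm (Csub q Cone) = 1 by rewrite /rho; field; lra.
have rho0 : 0 < rho by nra.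
have rle : rho <= rs.
  apply: (Rmult_le_reg_r (Cnorm (Csub q Cone))) => //; rewrite rhoq.
  have := Rmult_le_compat_l _ _ _ (Rlt_le _ _ rs0) hq'.
  by have -> : rs * (1 / rs) = 1 by field; lra.
have [r1 adm] : rho < 1 /\ admissible L rho.
  (* For [L = 2] the strict inequality on [|q - 1|] gives [rho < 1] and admissibility is a square;
     for [L >= 3] both follow from [rho <= rs]. *)
  case: hrs => [[L2 rs1]|[L3 [rs01 ers]]]; last first.
    by split; [lra | apply: admissible_below ers _ => //; lra].
  move: hq; rewrite /le_or_lt_R L2 eqxx rs1 /admissible /= => hq.
  by split; nra.
have reg := regime_intro hL (conj rho0 r1) rhoq adm.
apply: (ZG_nonzero reg sp mm) => e; case: (hv e) => [/(unit_wedge_m1 reg) //|[qv /le_or_lt_R_le h]].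
exact: unit_wedge_good hL reg qv h.
Qed.
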